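(* Assume that, as $N\to\infty$, $M\to\infty$, one has $n\to\infty$, $m\to\infty$, $p=n/N\to0$, $q=m/M\to0$. Upper bounds. Let $$\liminf\frac{a^2nm}{2\left(\log(p^{-1})+\log(q^{-1})\right)}>1,$$ and let $\eta=\eta_{nm}>0$ be taken in such a way that $\eta\to0$, $n\eta\to\infty$, $m\eta\to\infty$, $|\log\eta|=o(|\log(pq)|)$. Then $\gamma_{nm,a}(\psi_Z)\to0$ for the grid scan test $\psi_Z$. Lower bounds. Let $$\limsup\frac{a^2nm}{2\left(\log(p^{-1})+\log(q^{-1})\right)}<1 .$$ Then $\gamma_{nm,a}\to1$ and $\beta_{nm,a,\alpha}\to1-\alpha$ for any $\alpha\in(0,1)$.
   Context: Model: one observes an $N\times M$ matrix $\mathbf Y=\{Y_{ij}\}$, $Y_{ij}=s_{ij}+\xi_{ij}$, with $\xi_{ij}$ i.i.d. standard Gaussian and $s_{ij}\in\mathbb R$. $E_S$ denotes expectation when the mean matrix is $S=\{s_{ij}\}$; $E_0$ corresponds to $S=0$ (null hypothesis). The integers $n=n_{NM}\le N$, $m=m_{NM}\le M$ and $a=a_{NM}>0$ may depend on $N,M$; limits are as $N\to\infty$, $M\to\infty$; $p=n/N$, $q=m/M$. Block alternative: for $x,y\ge 0$ let $E_{xy}=\{(i,j)\in\mathbb Z^2: x<i\le x+n,\ y<j\le y+m\}$, and let $\mathcal E_{nm}=\{E_{kl}: 0\le k\le N-n,\ 0\le l\le M-m,\ k,l\in\mathbb Z\}$ (contiguous rectangles of size $n\times m$). $\mathcal S_{nm,a}$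 is the set of matrices $S$ for which there is $E\in\mathcal E_{nm}$ with $s_{ij}=0$ for $(i,j)\notin E$ and $s_{ij}\ge a$ for $(i,j)\in E$. A test is a measurable $\psi=\psi(\mathbf Y)\in[0,1]$; $\alpha(\psi)=E_0\psi$, $\beta_{nm,a}(\psi)=\sup_{S\in\mathcal S_{nm,a}}E_S(1-\psi)$, $\gamma_{nm,a}(\psi)=\alpha(\psi)+\beta_{nm,a}(\psi)$, $\gamma_{nm,a}=\inf_\psi\gamma_{nm,a}(\psi)$, $\beta_{nm,a,\alpha}=\inf_{\psi:\alpha(\psi)\le\alpha}\beta_{nm,a}(\psi)$. Grid scan test $\psi_Z$ with parameter $\eta=\eta_{nm}>0$: put $n_k=(k-1)n\eta$, $k=1,\dots,K$, and $m_l=(l-1)m\eta$, $l=1,\dots,L$, where $K,L$ are such that $N-n(1+\eta)\le n_K\le N-n$ and $M-m(1+\eta)\le m_L\le M-m$ (so $K\sim N/(\eta n)$, $L\sim M/(\eta m)$). Put $Z_{kl}=\frac1{\sqrt{nm}}\sum_{(i,j)\in E_{n_km_l}}Y_{ij}$, $Z=\max_{1\le k\le K,\,1\le l\le L}Z_{kl}$, $\psi_Z=\mathbf 1_{\{Z>\sqrt{2\log(KL)}\}}$. *)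

(* Defs.v *)
From HB Require Import structures.
From mathcomp Require Import all_boot all_order all_algebra.
From mathcomp Require Import all_classical all_reals all_analysis.

Set Implicit Arguments.
Unset Strict Implicit.
Unset Printing Implicit Defensive.

Import Order.TTheory GRing.Theory Num.Theory.
Import numFieldNormedType.Exports.

Local Open Scope classical_set_scope.
Local Open Scope ring_scope.

(* The limit "N -> oo, M -> oo" is taken jointly over pairs x = (N, M). *)
Notation NM_oo := (filter_prod \oo \oo).

(* Joint law of finitely many real random variables: the product rule over the
   whole family implies it for subfamilies, by taking B i j = setT. *)
Definition iid_std_normal (R : realType) (d : measure_display)
    (T : measurableType d) (P : probability T R) (N M : nat)
    (xi : 'I_N -> 'I_M -> {RV P >-> R}) : Prop :=
  (forall i j (A : set R), measurable A ->
     distribution P (xi i j) A = normal_prob 0 1 A) /\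
  (forall B : 'I_N -> 'I_M -> set R, (forall i j, measurable (B i j)) ->
     P [set w | forall i j, B i j (xi i j w)]
     = (\prod_(i < N) \prod_(j < M) P (xi i j @^-1` B i j))%E).

Definition observation (R : realType) (d : measure_display)
    (T : measurableType d) (P : probability T R) (N M : nat)
    (xi : 'I_N -> 'I_M -> {RV P >-> R}) (S : 'M[R]_(N, M)) (w : T) :
    'M[R]_(N, M) :=
  \matrix_(i, j) (S i j + xi i j w).

(* E_S f, the expectation of f(Y) when the mean matrix is S. *)
Definition expect (R : realType) (d : measure_display)
    (T : measurableType d) (P : probability T R) (N M : nat)
    (xi : 'I_N -> 'I_M -> {RV P >-> R}) (S : 'M[R]_(N, M))
    (f : 'M[R]_(N, M) -> R) : \bar R :=
  (\int[P]_w (f (observation xi S w))%:E)%E.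

(* These sets generate the Borel sigma-algebra of R^(N x M). *)
Definition mx_cylinders (R : realType) (N M : nat) :
    set (set 'M[R]_(N, M)) :=
  [set A | exists i j (B : set R),
     measurable B /\ A = [set Y : 'M[R]_(N, M) | B (Y i j)]].

Definition is_test (R : realType) (N M : nat) (psi : 'M[R]_(N, M) -> R) :
    Prop :=
  measurable_fun [set: g_sigma_algebraType (@mx_cylinders R N M)] psi /\
  forall Y, 0 <= psi Y <= 1.

(* The rows 1..N and columns 1..M are represented by 'I_N and 'I_M, so that
   the ordinals (i, j) stand for the matrix position (i.+1, j.+1). *)
Definition block (R : realType) (N M n m : nat) (x y : R) :
    {set 'I_N * 'I_M} :=
  [set ij : 'I_N * 'I_M | [&& x < ij.1.+1%:R, ij.1.+1%:R <= x + n%:R,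
                              y < ij.2.+1%:R & ij.2.+1%:R <= y + m%:R]].

Definition signals (R : realType) (N M n m : nat) (a : R) :
    set 'M[R]_(N, M) :=
  [set S : 'M[R]_(N, M) | exists k l : nat,
     [/\ (k + n <= N)%N, (l + m <= M)%N &
      forall i j,
        ((i, j) \notin block N M n m (k%:R : R) l%:R -> S i j = 0) /\
        ((i, j) \in block N M n m (k%:R : R) l%:R -> a <= S i j)]].

Definition type1 (R : realType) (d : measure_display)
    (T : measurableType d) (P : probability T R) (N M : nat)
    (xi : 'I_N -> 'I_M -> {RV P >-> R}) (psi : 'M[R]_(N, M) -> R) : \bar R :=
  expect xi 0 psi.

Definition type2 (R : realType) (d : measure_display)
    (T : measurableType d) (P : probability T R) (N M : nat)
    (xi : 'I_N -> 'I_M -> {RV P >-> R}) (n m : nat) (a : R)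
    (psi : 'M[R]_(N, M) -> R) : \bar R :=
  ereal_sup [set expect xi S (fun Y => 1 - psi Y) | S in signals n m a].

Definition total_error (R : realType) (d : measure_display)
    (T : measurableType d) (P : probability T R) (N M : nat)
    (xi : 'I_N -> 'I_M -> {RV P >-> R}) (n m : nat) (a : R)
    (psi : 'M[R]_(N, M) -> R) : \bar R :=
  (type1 xi psi + type2 xi n m a psi)%E.

Definition minimax_total_error (R : realType) (d : measure_display)
    (T : measurableType d) (P : probability T R) (N M : nat)
    (xi : 'I_N -> 'I_M -> {RV P >-> R}) (n m : nat) (a : R) : \bar R :=
  ereal_inf [set total_error xi n m a psi | psi in @is_test R N M].

Definition minimax_type2 (R : realType) (d : measure_display)
    (T : measurableType d) (P : probability T R) (N M : nat)
    (xi : 'I_N -> 'I_M -> {RV P >-> R}) (n m : nat) (a alpha : R) : \bar R :=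
  ereal_inf [set type2 xi n m a psi |
    psi in [set psi | is_test psi /\ (type1 xi psi <= alpha%:E)%E]].

(* For k >= 1; the grid points need not be integers. *)
Definition grid_pt (R : realType) (n : nat) (eta : R) (k : nat) : R :=
  (k%:R - 1) * n%:R * eta.

Definition grid_size (R : realType) (N n : nat) (eta : R) (K : nat) : Prop :=
  (0 < K)%N /\
  N%:R - n%:R * (1 + eta) <= grid_pt n eta K <= N%:R - n%:R.

Definition block_stat (R : realType) (N M n m : nat) (Y : 'M[R]_(N, M))
    (x y : R) : R :=
  (Num.sqrt (n * m)%:R)^-1 * \sum_(ij in block N M n m x y) Y ij.1 ij.2.

Definition scan_stat (R : realType) (N M n m : nat) (eta : R) (K L : nat)
    (Y : 'M[R]_(N, M)) : \bar R :=
  \big[maxe/-oo%E]_(1 <= k < K.+1) \big[maxe/-oo%E]_(1 <= l < L.+1)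
    (block_stat n m Y (grid_pt n eta k) (grid_pt m eta l))%:E.

Definition scan_test (R : realType) (N M n m : nat) (eta : R) (K L : nat)
    (Y : 'M[R]_(N, M)) : R :=
  if ((Num.sqrt (2 * ln (K * L)%:R))%:E < scan_stat n m eta K L Y)%E
  then 1 else 0.

Definition signal_ratio (R : realType) (N M n m : nat) (a : R) : R :=
  (a ^+ 2 * n%:R * m%:R) /
  (2 * (ln (n%:R / N%:R)^-1 + ln (m%:R / M%:R)^-1)).

(* Main.v *)
Require Import Defs.
From HB Require Import structures.
From mathcomp Require Import all_boot all_order all_algebra.
From mathcomp Require Import all_classical all_reals all_analysis.
From mathcomp Require Import measurable_realfun ring lra zify.

Set Implicit Arguments.
Unset Strict Implicit.
Unset Printing Implicit Defensive.

Import Order.TTheory GRing.Theory Num.Theory.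
Import numFieldNormedType.Exports.

Local Open Scope classical_set_scope.
Local Open Scope ring_scope.

(* All moments come from the Cameron-Martin formula E_S f = E_0 [f L_S], where
   L_S is the likelihood ratio: it is checked for a shift of one coordinate on
   rectangles, and general shifts are composed one coordinate at a time.

   Upper bound. A union bound over the K L grid blocks needs
   P (Z > t) = o (exp (- t^2 / 2)) for a normalised block sum Z.  Tilting by t
   reduces this to P (0 < Z <= 1/J) = O (1/J), which holds since the J
   translates of this interval in [0, 1] have comparable probabilities.  Every
   n x m block overlaps some grid block up to a factor 1 - o (1), so under the
   alternative some Z has mean exceeding the threshold by a diverging margin.

   Lower bound. Take the uniform mixture over B = (N %/ n) (M %/ m) disjoint
   blocks.  The likelihood ratios X_b satisfy E X_b X_c = 1 for b <> c; cutting
   them at level B, both the lost mass and the diagonal part of the second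
   moment are at most B^(-s) E X_b^(1+s), which tends to 0 for small s > 0 below
   the threshold.  Hence the mixture likelihood ratio is close to 1 and no test
   beats the trivial ones. *)

(** * Integration against a measure given by a density *)

Section density.
Context d (T : measurableType d) (R : realType).
Implicit Types mu nu : {measure set T -> \bar R}.

Import HBNNSimple.

(** By monotone convergence both sides are limits over simple functions increasing to [f]; for a
    simple function the hypothesis on [nu] applies to each level set. *)
Lemma ge0_integral_density mu nu (h f : T -> R) :
  measurable_fun setT h -> (forall x, 0 <= h x) ->
  (forall A, measurable A -> nu A = \int[mu]_(x in A) (h x)%:E)%E ->
  measurable_fun setT f -> (forall x, 0 <= f x) ->
  (\int[nu]_x (f x)%:E = \int[mu]_x (f x * h x)%:E)%E.
Proof.
move=> mh h0 nuE mf f0.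
have mE : measurable_fun setT (EFin \o f) by exact/measurable_EFinP.
pose g := nnsfun_approx (@measurableT _ T) mE.
have g_cvg x : (g n x)%:E @[n --> \oo] --> (f x)%:E.
  by apply: (cvg_nnsfun_approx measurableT mE) => // y _; rewrite lee_fin.
have g_nd x : {homo (fun n => (g n x)) : a b / (a <= b)%N >-> a <= b}.
  by move=> a b ab; exact/lefP/nd_nnsfun_approx.
have -> : (\int[nu]_x (f x)%:E = lim (\int[nu]_x (g n x)%:E @[n --> \oo]))%E.
  under eq_integral => x _ do rewrite -(cvg_lim _ (g_cvg x))//.
  apply: monotone_convergence => //.
  - by move=> n; exact/measurable_EFinP.
  - by move=> n x _; rewrite lee_fin.
  - by move=> x _ a b ab; rewrite lee_fin g_nd.
have gh_cvg x : (g n x * h x)%:E @[n --> \oo] --> (f x * h x)%:E.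
  under eq_fun do rewrite EFinM; rewrite EFinM.
  exact: (cvgeZr _ (g_cvg x)).
have -> : (\int[mu]_x (f x * h x)%:E =
    lim (\int[mu]_x (g n x * h x)%:E @[n --> \oo]))%E.
  under eq_integral => x _ do rewrite -(cvg_lim _ (gh_cvg x))//.
  apply: monotone_convergence => //.
  - by move=> n; apply/measurable_EFinP/measurable_funM.
  - by move=> n x _; rewrite lee_fin mulr_ge0.
  - by move=> x _ a b ab; rewrite lee_fin ler_wpM2r ?g_nd.
congr (lim (_ @ \oo)); apply/funext => n.
transitivity (\int[nu]_x
    (\sum_(y \in range (g n)) (y * \1_(g n @^-1` [set y]) x)%:E))%E.
  by apply: eq_integral => t _; rewrite fimfunE -fsumEFin.
rewrite ge0_integral_fsum//; last 2 first.
- by move=> r; apply/measurable_EFinP/measurable_funM.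
- by move=> r x _; exact: nnfun_muleindic_ge0.
transitivity (\int[mu]_x (\sum_(y \in range (g n))
    (y * \1_(g n @^-1` [set y]) x)%:E * (h x)%:E))%E; last first.
  apply: eq_integral => t _; rewrite -ge0_mule_fsuml.
    by rewrite fsumEFin// -fimfunE EFinM.
  by move=> y; exact: nnfun_muleindic_ge0.
rewrite ge0_integral_fsum//; last 2 first.
- move=> r; apply: emeasurable_funM; last exact/measurable_EFinP.
  by apply/measurable_EFinP/measurable_funM.
- by move=> r x _; rewrite mule_ge0 ?lee_fin ?h0//; exact: nnfun_muleindic_ge0.
apply: eq_fsbigr => r; rewrite inE => -[t _ gr].
have r0 : 0 <= r by rewrite -gr.
under eq_integral do rewrite EFinM.
rewrite integralZl_indic_nnsfun// integral_indic// setIT nuE//.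
under [RHS]eq_integral do rewrite EFinM -muleA.
rewrite ge0_integralZl//; first last.
- by move=> x _; rewrite mule_ge0 ?lee_fin ?h0.
- by apply: emeasurable_funM; exact/measurable_EFinP.
congr (_ * _)%E.
rewrite integral_mkcond; apply: eq_integral => x _.
by rewrite epatch_indic muleC.
Qed.

Lemma ge0_integral_scale mu nu (q : R) (f : T -> R) : 0 <= q ->
  (forall A, measurable A -> nu A = mu A * q%:E)%E ->
  measurable_fun setT f -> (forall x, 0 <= f x) ->
  (\int[nu]_x (f x)%:E = \int[mu]_x (f x)%:E * q%:E)%E.
Proof.
move=> q0 nuE mf f0; rewrite (@ge0_integral_density mu nu (fun=> q) f)//.
  under eq_integral do rewrite EFinM.
  rewrite ge0_integralZr//; first exact/measurable_EFinP.
  by move=> x _; rewrite lee_fin.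
by move=> A mA; rewrite (integral_cst mu mA q%:E) nuE// muleC.
Qed.

(* The measurability proof is an argument so that the instance below applies. *)
Definition density_measure mu (h : T -> R) (_ : measurable_fun setT h)
    (_ : forall x, 0 <= h x) (A : set T) : \bar R :=
  (\int[mu]_(x in A) (h x)%:E)%E.

Section density_measure_instance.
Variables (mu : {measure set T -> \bar R}) (h : T -> R).
Variables (mh : measurable_fun setT h) (h0 : forall x, 0 <= h x).

Local Notation nu := (density_measure mu mh h0).

Let nu0 : nu set0 = 0%E. Proof. by rewrite /density_measure integral_set0. Qed.

Let nu_ge0 A : (0 <= nu A)%E.
Proof. by apply: integral_ge0 => x _; rewrite lee_fin. Qed.

Let nu_sigma_additive : semi_sigma_additive nu.
Proof.
move=> F mF tF mUF; rewrite /density_measure ge0_integral_bigcup//.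
- by apply: is_cvg_ereal_nneg_natsum_cond => n _ _; exact: nu_ge0.
- by apply/measurable_EFinP; exact: measurable_funTS.
- by move=> x _; rewrite lee_fin.
Qed.

HB.instance Definition _ := isMeasure.Build _ _ _ nu nu0 nu_ge0
  nu_sigma_additive.

End density_measure_instance.

End density.

(** * Translation of the one-dimensional standard normal law *)

Section normal_shift.
Context (R : realType).

(** The pushforward by a translation still gives half-open intervals their length, which determines
    Lebesgue measure. *)
Lemma lebesgue_measure_shift (s : R) (A : set (measurableTypeR R)) :
  measurable A ->
  lebesgue_measure ((fun x => x + s) @^-1` A) = lebesgue_measure A.
Proof.
move=> mA.
have ms : measurable_fun setT
    ((fun x => x + s) : measurableTypeR R -> measurableTypeR R).
  by apply: measurable_funD.
pose nu : {measure set (measurableTypeR R) -> \bar R} :=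
  pushforward lebesgue_measure
    ((fun x => x + s) : measurableTypeR R -> measurableTypeR R).
apply/esym/(@lebesgue_measure_unique R (nu ms)) => // _ [[a b] /= _ <-].
rewrite /nu /= /pushforward.
rewrite (_ : _ @^-1` _ = `](a - s), (b - s)]%classic); last first.
  by apply/seteqP; split => x /=; rewrite !in_itv/=; lra.
rewrite !lebesgue_measure_itv /= !lte_fin ltrD2r.
by case: ifP => // _; rewrite -!EFinD; congr EFin; ring.
Qed.

(** One-dimensional Cameron-Martin formula. The right-hand integrand against Lebesgue measure,
    evaluated at [x + s], is [\1_B (x + s) * normal_pdf 0 1 x], because completing the square
    cancels the exponential. *)
Lemma normal_prob_shift (s : R) (B : set R) : measurable B ->
  (normal_prob 0 1 [set x : R | B (x + s)%R] =
   \int[normal_prob 0 1]_x (\1_B x * expR (s * x - s ^+ 2 / 2))%:E)%E.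
Proof.
move=> mB.
have peak0 : (1 : R) != 0 by exact: oner_neq0.
have mpdf := measurable_normal_pdf (0 : R) 1.
have pdf_ge0 := normal_pdf_ge0 (0 : R) 1.
have mf : measurable_fun setT (fun x : R => \1_B x * expR (s * x - s ^+ 2 / 2)).
  apply: measurable_funM; first exact: measurable_indic.
  apply: measurableT_comp => //; apply: measurable_funB => //.
rewrite (ge0_integral_density mpdf pdf_ge0 (mu := lebesgue_measure))//.
have ms : measurable_fun setT
    ((fun x => x + s) : measurableTypeR R -> measurableTypeR R).
  exact: measurable_funD.
pose g x : R := \1_B x * expR (s * x - s ^+ 2 / 2) * normal_pdf 0 1 x.
have mg : measurable_fun setT (EFin \o g).
  by apply/measurable_EFinP; exact: measurable_funM.
transitivity (\int[pushforward lebesgue_measure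
    ((fun x => x + s)%R : measurableTypeR R -> measurableTypeR R)]_(x in
    [set: R]) (EFin \o g) x)%E;
    last first.
  by apply: eq_measure_integral => A mA _; exact: lebesgue_measure_shift.
rewrite ge0_integral_pushforward//; last first.
  by move=> x _; rewrite lee_fin !mulr_ge0 ?expR_ge0.
rewrite preimage_setT /normal_prob [LHS]integral_mkcond.
apply: eq_integral => x _; rewrite /g /= /patch indicE.
have -> : ((x : R) \in [set y | B (y + s)]) = (x + s \in B).
  by apply/idP/idP => /set_mem => h; apply/mem_set.
case: ifP => _; last by rewrite !mul0r.
rewrite mul1r !normal_pdfE// /normal_fun mulrCA -expRD.
by congr ((_ * expR _)%:E); field.
Qed.

End normal_shift.

(** * The sigma-algebra on matrices and a generating pi-system *)

Definition mx_measurable (R : realType) (N M : nat) (f : 'M[R]_(N, M) -> R) :=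
  measurable_fun [set: g_sigma_algebraType (@mx_cylinders R N M)] f.

Section matrix_measurability.
Context (R : realType) (N M : nat).
Local Notation Mat := (g_sigma_algebraType (@mx_cylinders R N M)).

Lemma mx_measurable_coord i j : mx_measurable (fun Y : 'M[R]_(N, M) => Y i j).
Proof.
move=> _ B mB; rewrite setTI; apply: sub_sigma_algebra.
by exists i, j, B.
Qed.

Lemma measurable_to_mx d (T : measurableType d) (F : T -> 'M[R]_(N, M)) :
  (forall i j, measurable_fun setT (fun w => F w i j)) ->
  measurable_fun setT (F : T -> Mat).
Proof.
move=> mF; apply: (@measurability _ _ T Mat setT F (@mx_cylinders R N M)) => //.
move=> _ [_ [i [j [B [mB ->]]]] <-]; exact: mF.
Qed.

Lemma mx_measurable_shift (f : 'M[R]_(N, M) -> R) S :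
  mx_measurable f -> mx_measurable (fun Y => f (Y + S)).
Proof.
move=> mf.
have mS : measurable_fun [set: Mat] ((fun Y => Y + S) : Mat -> Mat).
  apply: measurable_to_mx => i j; under eq_fun do rewrite mxE.
  by apply: measurable_funD => //; exact: mx_measurable_coord.
exact: (measurableT_comp mf mS).
Qed.

(** Unlike the cylinders, which generate the same sigma-algebra, these sets are closed under
    intersection in every dimension, so finite measures can be compared on them. *)
Definition rectangles : set (set 'M[R]_(N, M)) :=
  [set A | exists2 B : 'I_N -> 'I_M -> set R, (forall i j, measurable (B i j)) &
    A = [set Y : 'M[R]_(N, M) | forall i j, B i j (Y i j)]].

Lemma measurable_rectangles : @measurable _ Mat = <<s rectangles >>.
Proof.
rewrite eqEsubset; split.
  apply: smallest_sub; first exact: smallest_sigma_algebra.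
  move=> _ [i [j [B [mB ->]]]]; apply: sub_sigma_algebra.
  exists (fun i' j' => if (i' == i) && (j' == j) then B else setT).
    by move=> i' j'; case: ifP.
  apply/seteqP; split => Y /= h; last by have := h i j; rewrite !eqxx.
  by move=> i' j'; case: ifP => // /andP[/eqP -> /eqP ->]; exact: h.
apply: smallest_sub; first exact: smallest_sigma_algebra.
move=> _ [B mB ->].
have -> : [set Y : 'M[R]_(N, M) | forall i j, B i j (Y i j)] =
    \big[setI/setT]_(p : 'I_N * 'I_M)
      [set Y : 'M[R]_(N, M) | B p.1 p.2 (Y p.1 p.2)].
  rewrite -bigcap_seq; apply/seteqP; split => Y /= h.
    by move=> p _; exact: h.
  by move=> i j; apply: (h (i, j)); rewrite /= mem_index_enum.
have mp p (_ : true) :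
    @measurable _ Mat [set Y : 'M[R]_(N, M) | B p.1 p.2 (Y p.1 p.2)].
  by apply: sub_sigma_algebra; exists p.1, p.2, (B p.1 p.2).
exact: (@bigsetI_measurable _ Mat _ _ _ _ mp).
Qed.

Lemma setI_closed_rectangles : setI_closed rectangles.
Proof.
move=> _ _ [B1 mB1 ->] [B2 mB2 ->].
exists (fun i j => B1 i j `&` B2 i j); first by move=> i j; exact: measurableI.
apply/seteqP; split => Y /=; first by move=> [h1 h2] i j.
by move=> h; split => i j; have [] := h i j.
Qed.

End matrix_measurability.

(** * The Cameron-Martin formula for a matrix of independent normal variables *)

Section cameron_martin.
Context (R : realType) (d : measure_display) (T : measurableType d)
  (P : probability T R) (N M : nat) (xi : 'I_N -> 'I_M -> {RV P >-> R}).
Hypothesis xi_iid : iid_std_normal xi.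
Local Notation Mat := (g_sigma_algebraType (@mx_cylinders R N M)).
Implicit Types (S : 'M[R]_(N, M)) (f : 'M[R]_(N, M) -> R).

Lemma measurable_observation S :
  measurable_fun setT (observation xi S : T -> Mat).
Proof.
apply: measurable_to_mx => i j; under eq_fun do rewrite mxE.
exact: measurable_funD.
Qed.

Lemma observationD S S' w :
  observation xi (S + S') w = observation xi S w + S'.
Proof. by apply/matrixP => i j; rewrite !mxE addrAC. Qed.

Lemma expectD S S' f :
  expect xi (S + S') f = expect xi S (fun Y => f (Y + S')).
Proof. by apply: eq_integral => w _; rewrite observationD. Qed.

Lemma measurable_comp_observation S f : mx_measurable f ->
  measurable_fun setT (fun w => f (observation xi S w)).
Proof.
move=> mf; exact: (measurableT_comp mf (measurable_observation S)).
Qed.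

(** The product rule for the family equal to [D] at [(i0, j0)] and to [B] elsewhere; it isolates the
    coordinate that is about to be shifted. *)
Lemma joint_law_split i0 j0 (D : set R) (B : 'I_N -> 'I_M -> set R) :
  measurable D -> (forall i j, measurable (B i j)) ->
  P [set w | D (xi i0 j0 w) /\
             forall i j, (i, j) != (i0, j0) -> B i j (xi i j w)] =
  (P (xi i0 j0 @^-1` D) *
   \prod_(p : 'I_N * 'I_M | p != (i0, j0)) P (xi p.1 p.2 @^-1` B p.1 p.2))%E.
Proof.
move=> mD mB.
pose U i j := if (i, j) == (i0, j0) then D else B i j.
have mU i j : measurable (U i j) by rewrite /U; case: ifP.
have -> : [set w | D (xi i0 j0 w) /\
    forall i j, (i, j) != (i0, j0) -> B i j (xi i j w)] =
    [set w | forall i j, U i j (xi i j w)].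
  apply/seteqP; split => w /=.
    move=> [wD wB] i j; rewrite /U.
    by case: eqP => [[-> ->]//|/eqP]; exact: wB.
  move=> wU; split; first by have := wU i0 j0; rewrite /U eqxx.
  by move=> i j /negbTE ne; have := wU i j; rewrite /U ne.
rewrite xi_iid.2// pair_big /= (bigD1 (i0, j0))//=; congr (_ * _)%E.
  by rewrite /U eqxx.
by apply: eq_bigr => -[i j] /= /negbTE ne; rewrite /U ne.
Qed.

(** By independence both sides are the probability [q] of the constraints on the other coordinates
    times a one-dimensional quantity, and these quantities agree by [normal_prob_shift]. *)
Lemma cameron_martin_rect i0 j0 (s : R) (B : 'I_N -> 'I_M -> set R) :
  (forall i j, measurable (B i j)) ->
  P [set w | forall i j, B i j (observation xi (s *: delta_mx i0 j0) w i j)] =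
  (\int[P]_(w in [set w | forall i j, B i j (observation xi 0 w i j)])
    (expR (s * xi i0 j0 w - s ^+ 2 / 2))%:E)%E.
Proof.
move=> mB.
(* The vacuous condition [setT] puts this event in the shape required by [joint_law_split]. *)
pose C := [set w | setT (xi i0 j0 w) /\
  forall i j, (i, j) != (i0, j0) -> B i j (xi i j w)].
pose q := (\prod_(p : 'I_N * 'I_M | p != (i0, j0))
  P (xi p.1 p.2 @^-1` B p.1 p.2))%E.
have law D : measurable D -> P (xi i0 j0 @^-1` D) = normal_prob 0 1 D.
  by move=> mD; rewrite -(xi_iid.1 i0 j0 _ mD).
have PC : P C = q.
  by rewrite joint_law_split// preimage_setT probability_setT mul1e.
have mC : measurable C.
  pose B' i j := if (i, j) == (i0, j0) then setT else B i j.
  have -> : C = observation xi 0 @^-1`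
      [set Y : 'M[R]_(N, M) | forall i j, B' i j (Y i j)].
    apply/seteqP; split => w /=; rewrite /B'.
      move=> [_ wB] i j; rewrite !mxE add0r.
      by case: eqP => // /eqP; exact: wB.
    move=> wB; split => // i j /negbTE ne.
    by have := wB i j; rewrite ne !mxE add0r.
  rewrite -[X in measurable X]setTI.
  apply: (measurable_observation 0) => //; rewrite measurable_rectangles.
  apply: sub_sigma_algebra; exists B' => // i j.
  by rewrite /B'; case: ifP.
have q_fin : q \is a fin_num by rewrite -PC fin_num_measure.
pose e (x : R) := expR (s * x - s ^+ 2 / 2).
have me : measurable_fun setT e.
  apply: measurableT_comp => //; apply: measurable_funB => //.
have mG : measurable_fun setT (fun x : R => \1_(B i0 j0) x * e x).
  by apply: measurable_funM => //; exact: measurable_indic.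
have G0 x : 0 <= \1_(B i0 j0) x * e x by rewrite mulr_ge0 ?expR_ge0.
transitivity ((\int[normal_prob 0 1]_x (\1_(B i0 j0) x * e x)%:E) * q)%E.
  have mS : measurable_fun setT (fun x : R => x + s) by exact: measurable_funD.
  have mBs : measurable [set x : R | B i0 j0 (x + s)].
    by have := mS measurableT _ (mB i0 j0); rewrite setTI.
  rewrite -normal_prob_shift// -law//.
  rewrite -joint_law_split//; congr (P _); apply/seteqP; split => w /=.
    move=> wB; split => [|i j ne].
      by have := wB i0 j0; rewrite !mxE !eqxx mulr1 addrC.
    have := wB i j; rewrite !mxE -[(i == i0) && _]/((i, j) == (i0, j0)).
    by rewrite (negbTE ne) mulr0 add0r.
  move=> [w0 wB] i j; rewrite !mxE.
  rewrite -[(i == i0) && _]/((i, j) == (i0, j0)).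
  case: eqP => [[-> ->]|/eqP ne]; first by rewrite mulr1 addrC.
  by rewrite mulr0 add0r; exact: wB.
pose X : T -> measurableTypeR R := xi i0 j0.
have mX : measurable_fun setT X.
  by move=> _ A mA; exact: (@measurable_funPT _ _ _ _ (xi i0 j0) measurableT).
(* By independence, the law of [xi i0 j0] under [P] restricted to [C] is [q] times the standard
   normal law. *)
pose nuX : {measure set (measurableTypeR R) -> \bar R} :=
  pushforward (mrestr P mC) X.
pose nu := mrestr P mC.
transitivity (\int[nuX mX]_x (\1_(B i0 j0) x * e x)%:E)%E.
  rewrite -(fineK q_fin); apply/esym/ge0_integral_scale => //.
    by rewrite fine_ge0// -PC.
  move=> A mA; rewrite fineK//.
  transitivity (P (X @^-1` A) * q)%E; last by congr (_ * _)%E; exact: law.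
  rewrite -joint_law_split//.
  by congr (P _); apply/seteqP; split => w /=; rewrite /C /=; tauto.
rewrite ge0_integral_pushforward//; last 2 first.
- exact/measurable_EFinP.
- by move=> x _; rewrite lee_fin.
rewrite preimage_setT.
have mGX : measurable_fun setT (fun w => \1_(B i0 j0) (X w) * e (X w)).
  exact: (measurableT_comp mG mX).
rewrite (@ge0_integral_density _ _ _ P nu \1_C
  (fun w => \1_(B i0 j0) (X w) * e (X w)))//; first last.
- by move=> A mA; rewrite integral_indic// setIC.
rewrite [RHS]integral_mkcond; apply: eq_integral => w _.
rewrite /patch !indicE.
have -> : (w \in [set w | forall i j, B i j (observation xi 0 w i j)]) =
    (X w \in B i0 j0) && (w \in C).
  apply/idP/andP => [/set_mem /= wB|[/set_mem Xw /set_mem[_ wB]]].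
    split; apply/mem_set; first by have := wB i0 j0; rewrite !mxE add0r.
    by split => // i j _; have := wB i j; rewrite !mxE add0r.
  apply/mem_set => i j; rewrite !mxE add0r.
  by have [[-> ->]//|/eqP] := (i, j) =P (i0, j0); exact: wB.
case: (X w \in B i0 j0); last by rewrite !mul0r.
by case: (w \in C); rewrite ?mulr0// mulr1 mul1r.
Qed.

(** The law of the shifted observation under [P] and that of the unshifted one under the tilted
    measure [Q] agree on rectangles, hence everywhere. *)
Lemma cameron_martin_coord i0 j0 (s : R) f : mx_measurable f ->
  (forall Y, 0 <= f Y) ->
  expect xi (s *: delta_mx i0 j0) f =
  expect xi 0 (fun Y => f Y * expR (s * Y i0 j0 - s ^+ 2 / 2)).
Proof.
move=> mf f0; set S := s *: _.
pose e (x : R) := expR (s * x - s ^+ 2 / 2).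
have me : measurable_fun setT e.
  apply: measurableT_comp => //; apply: measurable_funB => //.
pose h w := e (xi i0 j0 w).
have mh : measurable_fun setT h by exact: measurableT_comp.
have h0 w : 0 <= h w by exact: expR_ge0.
pose Q : {measure set T -> \bar R} := density_measure P mh h0.
have mO S' := measurable_observation S'.
have mfE : measurable_fun [set: Mat] (EFin \o f) by exact/measurable_EFinP.
have -> : expect xi S f =
    (\int[pushforward P (observation xi S : T -> Mat)]_(Y in [set: Mat])
      (EFin \o f) Y)%E.
  by rewrite ge0_integral_pushforward// => Y _; rewrite lee_fin.
rewrite (eq_measure_integral
    (pushforward Q (observation xi 0 : T -> Mat))) /=; last first.
  move=> A mA _.
  apply: (@measure_unique _ _ Mat (@rectangles R N M) (fun=> setT) _ _ _ _
    (pushforward P (observation xi S : T -> Mat))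
    (pushforward Q (observation xi 0 : T -> Mat))) => //.
  - exact: measurable_rectangles.
  - exact: setI_closed_rectangles.
  - by move=> _; exists (fun _ _ => setT) => //; apply/seteqP; split.
  - by rewrite bigcup_const//; exists 0%N.
  - move=> _ [B mB ->]; exact: cameron_martin_rect.
  - move=> k; apply: (@le_lt_trans _ _ (P setT)); last first.
      by rewrite probability_setT ltry.
    exact: lexx.
rewrite ge0_integral_pushforward//; last by move=> Y _; rewrite lee_fin.
transitivity (\int[Q]_w (f (observation xi 0 w))%:E)%E; first by [].
apply: etrans (@ge0_integral_density _ _ _ P Q h _ mh h0 _
  (measurable_comp_observation 0 mf) _) _ => //.
by apply: eq_integral => w _; rewrite /h /e !mxE add0r.
Qed.

(* The likelihood ratio of the mean matrix [S] against [0]. *)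
Definition lr S (Y : 'M[R]_(N, M)) : R :=
  expR (\sum_(p : 'I_N * 'I_M)
    (S p.1 p.2 * Y p.1 p.2 - S p.1 p.2 ^+ 2 / 2)).

(** Induction over a duplicate-free list of coordinates. As a new coordinate [p] is not in [s], its
    factor [expR (e p Y)] may be evaluated at [Y + part s]; it is then absorbed into the function to
    which the induction hypothesis applies. *)
Lemma cameron_martin S f : mx_measurable f -> (forall Y, 0 <= f Y) ->
  expect xi S f = expect xi 0 (fun Y => f Y * lr S Y).
Proof.
pose part (s : seq ('I_N * 'I_M)) : 'M[R]_(N, M) :=
  \sum_(p <- s) S p.1 p.2 *: delta_mx p.1 p.2.
pose e (p : 'I_N * 'I_M) (Y : 'M[R]_(N, M)) :=
  S p.1 p.2 * Y p.1 p.2 - S p.1 p.2 ^+ 2 / 2.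
have me p : mx_measurable (fun Y => expR (e p Y)).
  apply: measurableT_comp => //; apply: measurable_funB => //.
  by apply: measurable_funM => //; exact: mx_measurable_coord.
have part_notin s p Y : p \notin s -> (Y + part s) p.1 p.2 = Y p.1 p.2.
  move=> ps; rewrite mxE summxE big_seq big1 ?addr0// => r rs.
  rewrite !mxE; have [rp|] := eqVneq p r.
    by rewrite -rp (negbTE ps) in rs.
  case: p r {ps rs} => [p1 p2] [r1 r2] /=; rewrite xpair_eqE => /negbTE ->.
  by rewrite mulr0.
have step s : uniq s -> forall f, mx_measurable f -> (forall Y, 0 <= f Y) ->
    expect xi (part s) f =
    expect xi 0 (fun Y => f Y * expR (\sum_(p <- s) e p Y)).
  elim: s => [_ g mg g0|p s IH /= /andP[ps us] g mg g0].
    rewrite /part big_nil; apply: eq_integral => w _.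
    by rewrite big_nil expR0 mulr1.
  transitivity (expect xi (S p.1 p.2 *: delta_mx p.1 p.2)
      (fun Y => g (Y + part s))).
    by rewrite /part big_cons; exact: expectD.
  apply: etrans (cameron_martin_coord _ _ _ (mx_measurable_shift _ mg) _) _ => //.
  transitivity (expect xi 0 (fun Y =>
      (fun Z => g Z * expR (e p Z)) (Y + part s))).
    by apply: eq_integral => w _ /=; rewrite /e part_notin.
  transitivity (expect xi (0 + part s) (fun Z => g Z * expR (e p Z))).
    exact/esym/expectD.
  rewrite add0r; apply: etrans (IH us _ (measurable_funM mg (me p)) _) _.
    by move=> Y; rewrite mulr_ge0 ?expR_ge0.
  by apply: eq_integral => w _; rewrite big_cons (expRD (e p _)) /= mulrA.
move=> mf f0; rewrite [in LHS](matrix_sum_delta S) pair_big /=.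
by rewrite (step (index_enum _))// index_enum_uniq.
Qed.

End cameron_martin.

(** * Frobenius inner product and the algebra of likelihood ratios *)

Section frobenius.
Context (R : realType) (N M : nat).
Implicit Types (S V Y : 'M[R]_(N, M)) (A B : {set 'I_N * 'I_M}).

Definition frob S Y : R := \sum_(p : 'I_N * 'I_M) S p.1 p.2 * Y p.1 p.2.

Lemma frobDr S Y V : frob S (Y + V) = frob S Y + frob S V.
Proof.
by rewrite /frob -big_split; apply: eq_bigr => p _; rewrite mxE mulrDr.
Qed.

Lemma frobZr c S Y : frob S (c *: Y) = c * frob S Y.
Proof. by rewrite /frob mulr_sumr; apply: eq_bigr => p _; rewrite mxE mulrCA. Qed.

Lemma frobC S Y : frob S Y = frob Y S.
Proof. by apply: eq_bigr => p _; rewrite mulrC. Qed.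

Lemma frobDl S Y V : frob (S + V) Y = frob S Y + frob V Y.
Proof. by rewrite frobC frobDr !(frobC Y). Qed.

Lemma frobZl c S Y : frob (c *: S) Y = c * frob S Y.
Proof. by rewrite frobC frobZr frobC. Qed.

Lemma frobNl S Y : frob (- S) Y = - frob S Y.
Proof. by rewrite -scaleN1r frobZl mulN1r. Qed.

Definition ind_mx A : 'M[R]_(N, M) := \matrix_(i, j) ((i, j) \in A)%:R.

Lemma frob_ind A Y : frob (ind_mx A) Y = \sum_(p in A) Y p.1 p.2.
Proof.
rewrite /frob [RHS]big_mkcond; apply: eq_bigr => -[i j] _ /=.
by rewrite mxE; case: ifP => _; rewrite ?mul1r ?mul0r.
Qed.

Lemma frob_ind_ind A B : frob (ind_mx A) (ind_mx B) = #|A :&: B|%:R.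
Proof.
rewrite frob_ind -sum1_card natr_sum; under [RHS]eq_bigl do rewrite inE.
rewrite [RHS]big_mkcondr; apply: eq_bigr => -[i j] _.
by rewrite mxE; case: ifP.
Qed.

Lemma lrE S Y : lr S Y = expR (frob S Y - frob S S / 2).
Proof.
congr expR; rewrite /frob mulr_suml -sumrN -big_split /=.
by apply: eq_bigr => p _; rewrite expr2.
Qed.

(** The factor [expR (frob S V)] compensates the cross term of [frob (S + V) (S + V) / 2]. *)
Lemma lrD S V Y : lr S Y * lr V Y = lr (S + V) Y * expR (frob S V).
Proof.
rewrite !lrE -!expRD !frobDl !frobDr (frobC V S); congr (expR _); lra.
Qed.

End frobenius.

(** * Closure properties of measurable functions of a matrix *)

Section mx_measurable_theory.
Context (R : realType) (N M : nat).
Implicit Types (f g : 'M[R]_(N, M) -> R) (S : 'M[R]_(N, M)).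

Lemma mx_measurable_cst c : mx_measurable (fun _ : 'M[R]_(N, M) => c).
Proof. exact: measurable_cst. Qed.

Lemma mx_measurableD f g : mx_measurable f -> mx_measurable g ->
  mx_measurable (fun Y => f Y + g Y).
Proof. by move=> mf mg; exact: (measurable_funD mf mg). Qed.

Lemma mx_measurableB f g : mx_measurable f -> mx_measurable g ->
  mx_measurable (fun Y => f Y - g Y).
Proof. by move=> mf mg; exact: (measurable_funB mf mg). Qed.

Lemma mx_measurableM f g : mx_measurable f -> mx_measurable g ->
  mx_measurable (fun Y => f Y * g Y).
Proof. by move=> mf mg; exact: (measurable_funM mf mg). Qed.

Lemma mx_measurable_min f g : mx_measurable f -> mx_measurable g ->
  mx_measurable (fun Y => Num.min (f Y) (g Y)).
Proof. by move=> mf mg; exact: (measurable_minr mf mg). Qed.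

Lemma mx_measurable_sum (I : Type) (s : seq I) (F : I -> 'M[R]_(N, M) -> R) :
  (forall i, mx_measurable (F i)) ->
  mx_measurable (fun Y => \sum_(i <- s) F i Y).
Proof. by move=> mF; exact: (measurable_sum s mF). Qed.

Lemma mx_measurable_exp f : mx_measurable f ->
  mx_measurable (fun Y => expR (f Y)).
Proof. by move=> mf; exact: (measurableT_comp (@measurable_expR R) mf). Qed.

Lemma mx_measurable_lt f g : mx_measurable f -> mx_measurable g ->
  mx_measurable (fun Y => (f Y < g Y)%R%:R).
Proof.
move=> mf mg.
rewrite (_ : (fun Y => _) = (fun Y => if f Y < g Y then 1 else 0)); last first.
  by apply/funext => Y; case: ifP.
by apply: measurable_fun_ifT => //; exact: (measurable_fun_ltr mf mg).
Qed.

Lemma mx_measurable_frob S : mx_measurable (frob S).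
Proof.
apply: mx_measurable_sum => p; apply: mx_measurableM.
  exact: mx_measurable_cst.
exact: mx_measurable_coord.
Qed.

Lemma mx_measurable_lr S : mx_measurable (lr S).
Proof.
rewrite (_ : lr S = fun Y => expR (frob S Y - frob S S / 2)); last first.
  by apply/funext => Y; rewrite lrE.
apply: mx_measurable_exp; apply: mx_measurableB; first exact: mx_measurable_frob.
exact: mx_measurable_cst.
Qed.

End mx_measurable_theory.

(** * Expectations of nonnegative functions and exponential moments *)

Section expect_theory.
Context (R : realType) (d : measure_display) (T : measurableType d)
  (P : probability T R) (N M : nat) (xi : 'I_N -> 'I_M -> {RV P >-> R}).
Implicit Types (S V : 'M[R]_(N, M)) (f g : 'M[R]_(N, M) -> R).

Let mEf S f : mx_measurable f ->
  measurable_fun setT (fun w => (f (observation xi S w))%:E).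
Proof. by move=> mf; exact/measurable_EFinP/measurable_comp_observation. Qed.

Lemma expect_ge0 S f : (forall Y, 0 <= f Y) -> (0 <= expect xi S f)%E.
Proof. by move=> f0; apply: integral_ge0 => w _; rewrite lee_fin. Qed.

Lemma expect_le S f g : mx_measurable f -> mx_measurable g ->
  (forall Y, 0 <= f Y <= g Y) -> (expect xi S f <= expect xi S g)%E.
Proof.
move=> mf mg fg; apply: ge0_le_integral => //; try exact: mEf.
- by move=> w _; rewrite lee_fin; have /andP[] := fg (observation xi S w).
- by move=> w _; rewrite lee_fin; have /andP[] := fg (observation xi S w).
Qed.

Lemma expect_cst S c : expect xi S (fun=> c) = c%:E.
Proof.
transitivity (c%:E * P setT)%E; last by rewrite probability_setT mule1.
exact: (integral_cst P measurableT c%:E).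
Qed.

Lemma expect_fin_num S c f : mx_measurable f -> (forall Y, 0 <= f Y <= c) ->
  expect xi S f \is a fin_num.
Proof.
move=> mf fc; rewrite ge0_fin_numE; last first.
  by apply: expect_ge0 => Y; have /andP[] := fc Y.
apply: (@le_lt_trans _ _ (expect xi S (fun=> c))).
  by apply: expect_le => //; exact: mx_measurable_cst.
by rewrite expect_cst ltry.
Qed.

Lemma expectZ S c f : mx_measurable f -> (forall Y, 0 <= f Y) -> 0 <= c ->
  expect xi S (fun Y => c * f Y) = (c%:E * expect xi S f)%E.
Proof.
move=> mf f0 c0; rewrite /expect.
under eq_integral do rewrite EFinM.
rewrite ge0_integralZl//; first exact: mEf.
by move=> w _; rewrite lee_fin.
Qed.

Lemma expect_add S f g : mx_measurable f -> mx_measurable g ->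
  (forall Y, 0 <= f Y) -> (forall Y, 0 <= g Y) ->
  expect xi S (fun Y => f Y + g Y) = (expect xi S f + expect xi S g)%E.
Proof.
move=> mf mg f0 g0; rewrite /expect.
under eq_integral do rewrite EFinD.
rewrite ge0_integralD//.
- by move=> w _; rewrite lee_fin.
- exact: mEf.
- by move=> w _; rewrite lee_fin.
- exact: mEf.
Qed.

Lemma expect_sum S (I : Type) (s : seq I) (F : I -> 'M[R]_(N, M) -> R) :
  (forall i, mx_measurable (F i)) -> (forall i Y, 0 <= F i Y) ->
  (expect xi S (fun Y => (\sum_(i <- s) F i Y)%R) =
   \sum_(i <- s) expect xi S (F i))%E.
Proof.
move=> mF F0; elim: s => [|i s IH].
  rewrite big_nil -[RHS](expect_cst S 0); apply: eq_integral => w _.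
  by rewrite big_nil.
rewrite big_cons -IH -expect_add//.
- by apply: eq_integral => w _; rewrite big_cons.
- exact: mx_measurable_sum.
- by move=> Y; exact: sumr_ge0.
Qed.

Hypothesis xi_iid : iid_std_normal xi.

Lemma expect_shift S f : mx_measurable f -> (forall Y, 0 <= f Y) ->
  expect xi 0 (fun Y => f (Y + S)) = expect xi 0 (fun Y => f Y * lr S Y).
Proof. by move=> mf f0; rewrite -cameron_martin// -expectD add0r. Qed.

Lemma expect_lr S : expect xi 0 (lr S) = 1%E.
Proof.
rewrite -[RHS](expect_cst S 1) [RHS]cameron_martin//.
  by apply: eq_integral => w _; rewrite mul1r.
exact: mx_measurable_cst.
Qed.

(** The integrand is [expR (frob S S / 2)] times [lr S], whose expectation is 1. *)
Lemma expect_expR S : expect xi 0 (fun Y => expR (frob S Y)) =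
  (expR (frob S S / 2))%:E.
Proof.
transitivity (expect xi 0 (fun Y => expR (frob S S / 2) * lr S Y)).
  by apply: eq_integral => w _; rewrite lrE -expRD addrC subrK.
rewrite expectZ ?expect_lr ?mule1 ?expR_ge0//; first exact: mx_measurable_lr.
by move=> Y; exact: expR_ge0.
Qed.

(** Second moments for the lower bound: for orthogonal [S] and [V] the value is 1, as for
    independent factors. *)
Lemma expect_lrM S V : expect xi 0 (fun Y => lr S Y * lr V Y) =
  (expR (frob S V))%:E.
Proof.
transitivity (expect xi 0 (fun Y => expR (frob S V) * lr (S + V) Y)).
  by apply: eq_integral => w _; rewrite lrD mulrC.
rewrite expectZ ?expect_lr ?mule1 ?expR_ge0//; first exact: mx_measurable_lr.
by move=> Y; exact: expR_ge0.
Qed.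

End expect_theory.

(** * Tail of a Gaussian linear form of unit variance *)

Section gaussian_tail.
Context (R : realType) (d : measure_display) (T : measurableType d)
  (P : probability T R) (N M : nat) (xi : 'I_N -> 'I_M -> {RV P >-> R}).
Hypothesis xi_iid : iid_std_normal xi.
Variable V : 'M[R]_(N, M).
Hypothesis V1 : frob V V = 1.

(** For [a <= b], the indicator of [a < frob V Y <= b]; written as a difference, it telescopes over
    adjacent intervals. *)
Let ivl (a b : R) (Y : 'M[R]_(N, M)) : R :=
  (a < frob V Y)%R%:R - (b < frob V Y)%R%:R.

Let ivl_ge0 a b Y : a <= b -> 0 <= ivl a b Y.
Proof.
move=> ab; rewrite /ivl subr_ge0 ler_nat.
by case: ltP => // /(le_lt_trans ab) ->.
Qed.

Let ivl_le1 a b Y : ivl a b Y <= 1.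
Proof.
by rewrite lerBlDr -(natrD _ 1%N) ler_nat (leq_trans (leq_b1 _))// leq_addr.
Qed.

Let m_gt a : mx_measurable (fun Y => (a < frob V Y)%R%:R : R).
Proof.
by apply: mx_measurable_lt; [exact: mx_measurable_cst|exact: mx_measurable_frob].
Qed.

Let m_ivl a b : mx_measurable (ivl a b).
Proof. exact: mx_measurableB. Qed.

Let frob_shift c Y : frob V (Y + c *: V) = frob V Y + c.
Proof. by rewrite frobDr frobZr V1 mulr1. Qed.

Let lr_tilt c Y : lr (c *: V) Y = expR (c * frob V Y - c ^+ 2 / 2).
Proof. by rewrite lrE !frobZl frobZr V1 mulr1 expr2. Qed.

(* Translating the law of [frob V] by [c] in [0, 1] changes the probability of
   a subinterval of [0, 1] by a factor at most [e]. *)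
Let ivl_translate (c b : R) : 0 <= c -> 0 <= b -> c + b <= 1 ->
  (expect xi 0 (ivl 0 b) <= (expR 1)%:E * expect xi 0 (ivl c (c + b)))%E.
Proof.
move=> c0 b0 cb1; have ccb : c <= c + b by rewrite lerDl.
have ge0 Y := @ivl_ge0 c (c + b) Y ccb.
rewrite (_ : ivl 0 b = fun Y => ivl c (c + b) (Y + c *: V)); last first.
  apply/funext => Y; rewrite /ivl frob_shift.
  by rewrite -ltrBlDr subrr -[c + b < _]ltrBlDr addrAC subrr add0r.
rewrite expect_shift// -expectZ ?expR_ge0//; apply: expect_le.
- by apply: mx_measurableM => //; exact: mx_measurable_lr.
- by apply: mx_measurableM => //; exact: mx_measurable_cst.
move=> Y; rewrite mulr_ge0 ?expR_ge0//= mulrC lr_tilt /ivl.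
have [cW|Wc] := ltP c (frob V Y); last first.
  by rewrite ltNge (le_trans Wc)// subr0 !mulr0.
have [_|Wb] := ltP (c + b) (frob V Y); first by rewrite subrr !mulr0.
by rewrite subr0 !mulr1 ler_expR; nra.
Qed.

(** The [J] adjacent intervals of length [J%:R^-1] that fill []0, 1]] have total probability at most
    1, and each has at least [expR (-1)] times the probability of the first. *)
Lemma gaussian_anticoncentration (J : nat) : (0 < J)%N ->
  (expect xi 0 (fun Y => ((0 < frob V Y)%R%:R - (J%:R^-1 < frob V Y)%R%:R)%R)
   <= (expR 1 / J%:R)%:E)%E.
Proof.
move=> J0; have JR : 0 < J%:R :> R by rewrite ltr0n.
pose t (k : nat) : R := k%:R / J%:R.
have tS k : t k.+1 = t k + J%:R^-1 by rewrite /t -natr1 mulrDl mul1r.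
have t_ge0 k : 0 <= t k by rewrite divr_ge0 ?ler0n ?ltW.
have t_nd k : t k <= t k.+1 by rewrite tS lerDl invr_ge0 ltW.
change ((expect xi 0 (ivl 0 J%:R^-1) <= (expR 1 / J%:R)%:E)%E).
set E := expect _ _ _.
have sum_le : (\sum_(k < J) E <= (expR 1)%:E)%E.
  apply: (@le_trans _ _ (\sum_(k < J)
      (expR 1)%:E * expect xi 0 (ivl (t k) (t k.+1)))%E).
    apply: lee_sum => k _; rewrite tS; apply: ivl_translate => //.
    by rewrite -tS ler_pdivrMr// mul1r ler_nat.
  rewrite -ge0_sume_distrr; last first.
    by move=> k _; apply: expect_ge0 => Y; exact: ivl_ge0.
  rewrite -expect_sum//; last by move=> k Y; exact: ivl_ge0.
  rewrite -[leRHS]mule1 lee_pmul2l ?lte_fin ?expR_gt0//.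
  rewrite -(expect_cst xi 0 1); apply: expect_le.
  - exact: mx_measurable_sum.
  - exact: mx_measurable_cst.
  move=> Y; rewrite sumr_ge0 /=; last by move=> k _; exact: ivl_ge0.
  have -> n : \sum_(k < n) ivl (t k) (t k.+1) Y = ivl (t 0) (t n) Y.
    elim: n => [|n IH]; first by rewrite big_ord0 /ivl subrr.
    by rewrite big_ord_recr /= IH /ivl addrA subrK.
  exact: ivl_le1.
have E_fin : E \is a fin_num.
  apply: (@expect_fin_num _ _ _ _ _ _ _ _ 1) => // Y.
  by rewrite ivl_ge0 ?ivl_le1 ?invr_ge0 ?(ltW JR).
move: sum_le; rewrite -(fineK E_fin) sumEFin sumr_const card_ord !lee_fin.
by rewrite ler_pdivlMr// mulr_natr.
Qed.

(** Tilting by [t] leaves [expR (- t ^+ 2 / 2)] times the expectation of [expR (- t * W)] over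
    [W > 0], with [W] standing for [frob V Y]. The integrand is at most 1 for [W <= J%:R^-1], where
    anticoncentration applies, and at most [expR (- t / J%:R)] beyond. *)
Lemma gaussian_tail (J : nat) (t : R) : (0 < J)%N -> 0 <= t ->
  (expect xi 0 (fun Y => (t < frob V Y)%R%:R)
   <= (expR (- t ^+ 2 / 2) * (expR 1 / J%:R + expR (- t / J%:R)))%R%:E)%E.
Proof.
move=> J0 t0; have JR : 0 <= J%:R^-1 :> R by rewrite invr_ge0.
(* The indicator divided by [lr (t *: V)], so that Cameron-Martin replaces its argument by
   [Y + t *: V]. *)
pose g Y := (t < frob V Y)%R%:R * expR (- t * frob V Y + t ^+ 2 / 2).
have mg : mx_measurable g.
  apply: mx_measurableM => //; apply: mx_measurable_exp.
  apply: mx_measurableD; last exact: mx_measurable_cst.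
  by apply: mx_measurableM; [exact: mx_measurable_cst|exact: mx_measurable_frob].
rewrite (_ : (fun Y => (t < frob V Y)%R%:R) =
    (fun Y => g Y * lr (t *: V) Y)); last first.
  apply/funext => Y; rewrite lr_tilt /g -mulrA -expRD.
  by rewrite (_ : _ + _ = 0) ?expR0 ?mulr1//; ring.
rewrite -expect_shift//; last by move=> Y; rewrite mulr_ge0 ?expR_ge0.
apply: (@le_trans _ _ (expect xi 0 (fun Y => (expR (- t ^+ 2 / 2) *
    (ivl 0 J%:R^-1 Y + expR (- t / J%:R)))%R))).
  apply: expect_le.
  - exact: mx_measurable_shift.
  - apply: mx_measurableM; first exact: mx_measurable_cst.
    by apply: mx_measurableD => //; exact: mx_measurable_cst.
  move=> Y; rewrite mulr_ge0 ?expR_ge0//= /g frob_shift -ltrBlDr subrr.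
  have -> : - t * (frob V Y + t) + t ^+ 2 / 2 = - t ^+ 2 / 2 + - t * frob V Y.
    by field.
  rewrite expRD mulrCA ler_pM2l ?expR_gt0// /ivl.
  have [W0|W0] := ltP 0 (frob V Y); last first.
    rewrite mul0r ltNge (le_trans W0)//= subrr add0r expR_ge0//.
  have [WJ|WJ] := ltP J%:R^-1 (frob V Y).
    by rewrite mul1r subrr add0r ler_expR !mulNr lerN2 ler_wpM2l// ltW.
  rewrite mul1r subr0 (@le_trans _ _ 1)// ?lerDl ?expR_ge0//.
  by rewrite -expR0 ler_expR mulNr oppr_le0 mulr_ge0// ltW.
rewrite expectZ ?expR_ge0//; last 2 first.
- by apply: mx_measurableD => //; exact: mx_measurable_cst.
- by move=> Y; rewrite addr_ge0 ?expR_ge0// ivl_ge0.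
rewrite EFinM lee_pmul2l ?lte_fin ?expR_gt0//.
rewrite expect_add//; last 2 first.
- exact: mx_measurable_cst.
- by move=> Y; rewrite ivl_ge0.
by rewrite expect_cst EFinD leeD2r// gaussian_anticoncentration.
Qed.

End gaussian_tail.

(** * Geometry of blocks: cardinality, overlap and covering by the grid *)

Section blocks.
Context (R : realType).

Definition ord_itv (N k l : nat) : {set 'I_N} := [set i : 'I_N | (k <= i < l)%N].

Lemma card_ord_itv N k l : (l <= N)%N -> #|ord_itv N k l| = (l - k)%N.
Proof.
move=> lN; rewrite -[RHS]muln1 -sum_nat_const_nat big_geq_mkord.
rewrite (big_ord_widen_cond N (fun i => k <= i)%N (fun=> 1%N))// -sum1_card.
by apply: eq_bigl => i; rewrite inE.
Qed.

Lemma card_ord_itv_overlap K z p q : (z <= p)%N -> (p + q <= K)%N ->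
  (z + q - p <= #|ord_itv K z (z + q) :&: ord_itv K p (p + q)|)%N.
Proof.
move=> zp pK; rewrite -(@card_ord_itv K); last first.
  by apply: leq_trans pK; rewrite leq_add2r.
apply/subset_leq_card/fintype.subsetP => i; rewrite !inE => /andP[pi iz].
by rewrite (leq_trans zp pi) iz pi (leq_trans iz)// leq_add2r.
Qed.

(** Since [x < i.+1%:R] means [Num.truncn x <= i], a real corner can be rounded down; the block
    becomes a product of intervals of 0-based indices. *)
Lemma block_nat N M n m (x y : R) : 0 <= x -> 0 <= y ->
  block N M n m x y =
  finset.setX (ord_itv N (Num.truncn x) (Num.truncn x + n))
              (ord_itv M (Num.truncn y) (Num.truncn y + m)).
Proof.
have side (z : R) (p i : nat) : 0 <= z ->
    ((z < i.+1%:R) && (i.+1%:R <= z + p%:R)) =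
    (Num.truncn z <= i < Num.truncn z + p)%N.
  move=> z0; rewrite -truncn_lt_nat// ltnS; congr (_ && _).
  have [ip|pi] := ltnP i p.
    rewrite (leq_trans ip) ?leq_addl//; apply/idP.
    by rewrite (@le_trans _ _ p%:R)// ?ler_nat ?lerDr.
  rewrite -lerBlDr -natrB; last exact: leqW.
  by rewrite -truncn_ge_nat// leq_subLR addnC.
move=> x0 y0; apply/setP => -[i j].
by rewrite !inE /= -!side// -!andbA.
Qed.

Lemma truncn_block N n (x : R) : 0 <= x -> x + n%:R <= N%:R ->
  (Num.truncn x + n <= N)%N.
Proof.
move=> x0 xnN; rewrite -(ler_nat R) natrD (le_trans _ xnN)// lerD2r.
by rewrite truncn_le.
Qed.

Lemma card_block N M n m (x y : R) : 0 <= x -> 0 <= y ->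
  x + n%:R <= N%:R -> y + m%:R <= M%:R -> #|block N M n m x y| = (n * m)%N.
Proof.
move=> x0 y0 xN yM; rewrite block_nat// cardsX !card_ord_itv ?truncn_block//.
by rewrite !addKn.
Qed.

(** In each direction, for a side of length [q], the offset costs at most [q * e] indices and
    rounding the corner at most one more. The conditions [n%:R^-1 + e <= 1] and [m%:R^-1 + e <= 1]
    keep both factors nonnegative, so the two bounds multiply. *)
Lemma card_block_overlap N M n m (x y : R) k l (e : R) : 0 <= x -> 0 <= y ->
  (k + n <= N)%N -> (l + m <= M)%N -> x <= k%:R <= x + n%:R * e ->
  y <= l%:R <= y + m%:R * e -> 0 <= e ->
  (0 < n)%N -> (0 < m)%N -> n%:R^-1 + e <= 1 -> m%:R^-1 + e <= 1 ->
  n%:R * m%:R * ((1 - n%:R^-1 - e) * (1 - m%:R^-1 - e)) <=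
  #|block N M n m x y :&: block N M n m (k%:R : R) l%:R|%:R :> R.
Proof.
move=> x0 y0 kN lM /andP[xk kx] /andP[yl ly] e0 n0 m0 ne me.
rewrite !block_nat ?ler0n//.
have side (z : R) (K p q : nat) : 0 <= z -> (p + q <= K)%N ->
    z <= p%:R <= z + q%:R * e -> (0 < q)%N -> q%:R * (1 - q%:R^-1 - e) <=
    #|ord_itv K (Num.truncn z) (Num.truncn z + q) :&:
      ord_itv K (Num.truncn (p%:R : R)) (Num.truncn (p%:R : R) + q)|%:R :> R.
  move=> z0 pK /andP[zp pz] q0; rewrite natrK.
  have tp : (Num.truncn z <= p)%N by rewrite truncn_le_nat (le_lt_trans zp)// ltr_nat.
  apply: (@le_trans _ _ (Num.truncn z + q - p)%N%:R); last first.
    by rewrite ler_nat card_ord_itv_overlap.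
  have := truncnS_gt z; rewrite -natr1 => zt.
  have q0R : q%:R != 0 :> R by rewrite pnatr_eq0 -lt0n.
  have -> : q%:R * (1 - q%:R^-1 - e) = q%:R - 1 - q%:R * e by field.
  (* In the second case the natural subtraction is 0 and the left-hand side is negative. *)
  have [h|h] := leqP p (Num.truncn z + q).
    by rewrite natrB// natrD; lra.
  have : (Num.truncn z + q)%:R < p%:R :> R by rewrite ltr_nat.
  by rewrite natrD; have := ler0n R (Num.truncn z + q - p)%N; lra.
have n0R : 0 < n%:R :> R by rewrite ltr0n.
have m0R : 0 < m%:R :> R by rewrite ltr0n.
have -> (A B : {set 'I_N}) (C D : {set 'I_M}) :
    finset.setX A C :&: finset.setX B D = finset.setX (A :&: B) (C :&: D).
  by apply/setP => -[i j]; rewrite !inE andbACA.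
rewrite cardsX natrM mulrACA ler_pM//.
- by rewrite mulr_ge0 ?ler0n//; lra.
- by rewrite mulr_ge0 ?ler0n//; lra.
- by apply: side => //; rewrite xk kx.
- by apply: side => //; rewrite yl ly.
Qed.

Lemma grid_cover N n (eta : R) K k : (0 < n)%N -> 0 < eta ->
  grid_size N n eta K -> (k + n <= N)%N ->
  exists2 c, (1 <= c <= K)%N &
    0 <= grid_pt n eta c /\
    grid_pt n eta c <= k%:R <= grid_pt n eta c + n%:R * eta.
Proof.
move=> n0 eta0 [K0 /andP[NK KN]] kN.
have n0R : 0 < n%:R :> R by rewrite ltr0n.
have h0 : 0 < n%:R * eta by rewrite mulr_gt0.
have pt_ge0 c : (0 < c)%N -> 0 <= grid_pt n eta c.
  by move=> c0; rewrite /grid_pt -mulrA mulr_ge0 ?(ltW h0)// subr_ge0 ler1n.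
have kNR : k%:R <= N%:R - n%:R :> R by rewrite lerBrDr -natrD ler_nat.
(* The last point at or before [k] of the grid continued indefinitely; the successor is due to the
   numbering from 1. *)
pose c := (Num.truncn (k%:R / (n%:R * eta))).+1.
have u0 : 0 <= k%:R / (n%:R * eta) :> R by rewrite divr_ge0 ?ler0n ?ltW.
have tru : (Num.truncn (k%:R / (n%:R * eta)))%:R <= k%:R / (n%:R * eta) :> R.
  by rewrite truncn_le.
have [cK|Kc] := leqP c K.
  exists c; first by rewrite cK.
  split; first exact: pt_ge0.
  have := truncnS_gt (k%:R / (n%:R * eta)) : _ < _.
  rewrite -/c; move: tru; rewrite /grid_pt /c -natr1 addrK -mulrA.
  rewrite ler_pdivlMr// ltr_pdivrMr// mulrDl mul1r => -> /ltW ->.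
  by [].
(* The actual grid ends before [c]: its last point is at most [k], and within [n * eta] of [N - n],
   which is at least [k]. *)
exists K; first by rewrite K0 leqnn.
split; first exact: pt_ge0.
apply/andP; split; last by lra.
rewrite /grid_pt -mulrA -ler_pdivlMr// (le_trans _ tru)//.
by rewrite lerBlDr natr1 ler_nat ltnW.
Qed.

End blocks.

(** * The two error probabilities of the scan test *)

Section scan_test.
Context (R : realType) (d : measure_display) (T : measurableType d)
  (P : probability T R) (N M : nat) (xi : 'I_N -> 'I_M -> {RV P >-> R}).
Hypothesis xi_iid : iid_std_normal xi.
Variables (n m : nat) (eta : R) (K L : nat).
Hypotheses (n0 : (0 < n)%N) (m0 : (0 < m)%N).

Local Notation r := (Num.sqrt (n * m)%:R : R).
Local Notation H := (Num.sqrt (2 * ln (K * L)%:R) : R).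

Let nm0 : 0 < (n * m)%:R :> R.
Proof. by rewrite ltr0n muln_gt0 n0. Qed.

Let r0 : 0 < r. Proof. by rewrite sqrtr_gt0. Qed.

(** The direction whose inner product with [Y] is the block statistic; it has norm 1 when the block
    fits in the matrix. *)
Definition block_dir (x y : R) : 'M[R]_(N, M) :=
  r^-1 *: ind_mx R (block N M n m x y).

Lemma block_statE (Y : 'M[R]_(N, M)) x y : block_stat n m Y x y = frob (block_dir x y) Y.
Proof. by rewrite frobZl frob_ind. Qed.

Lemma frob_block_dir x y : 0 <= x -> 0 <= y ->
  x + n%:R <= N%:R -> y + m%:R <= M%:R ->
  frob (block_dir x y) (block_dir x y) = 1.
Proof.
move=> x0 y0 xN yM; rewrite frobZl frobZr frob_ind_ind finset.setIid card_block//.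
by rewrite mulrA -invfM -expr2 sqr_sqrtr ?(ltW nm0)// mulVf// gt_eqF.
Qed.

Lemma scan_leP (Y : 'M[R]_(N, M)) (h : R) : reflect
  (forall (k : 'I_K) (l : 'I_L),
    block_stat n m Y (grid_pt n eta k.+1) (grid_pt m eta l.+1) <= h)
  (scan_stat n m eta K L Y <= h%:E)%E.
Proof.
rewrite /scan_stat big_add1 big_mkord /=.
apply: (iffP (bigmax_leP _ _ _ _)) => [[_ h1] k l|h1].
  have := h1 k isT; rewrite big_add1 big_mkord /= => /bigmax_leP[_ h2].
  by have := h2 l isT; rewrite lee_fin.
split; first exact: leNye.
move=> k _; rewrite big_add1 big_mkord /=; apply/bigmax_leP.
split; first exact: leNye.
by move=> l _; rewrite lee_fin; exact: h1.
Qed.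

Lemma scan_testE (Y : 'M[R]_(N, M)) :
  scan_test n m eta K L Y = (~~ (scan_stat n m eta K L Y <= H%:E)%E)%:R.
Proof. by rewrite /scan_test -ltNge; case: ifP. Qed.

Lemma mx_measurable_scan_test :
  mx_measurable (@scan_test R N M n m eta K L).
Proof.
pose Mat := g_sigma_algebraType (@mx_cylinders R N M).
have mmax (s : seq nat) (F : nat -> Mat -> \bar R) :
    (forall k, measurable_fun setT (F k)) ->
    measurable_fun setT (fun Y => \big[maxe/-oo%E]_(k <- s) F k Y).
  move=> mF; elim: s => [|k s IH].
    by under eq_fun do rewrite big_nil; exact: measurable_cst.
  by under eq_fun do rewrite big_cons; exact: measurable_maxe.
apply: measurable_fun_ifT => //.
apply: measurable_fun_lte => //.
apply: (mmax _ _) => k; apply: (mmax _ _) => l; apply/measurable_EFinP.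
under eq_fun do rewrite block_statE.
exact: mx_measurable_frob.
Qed.

Lemma is_test_scan_test : is_test (@scan_test R N M n m eta K L).
Proof.
split; first exact: mx_measurable_scan_test.
by move=> Y; rewrite scan_testE; case: (_ <= _)%E; rewrite ?lexx ?ler01.
Qed.

Hypotheses (eta0 : 0 < eta) (gK : grid_size N n eta K)
  (gL : grid_size M m eta L).

Let grid_pt_range (D p J : nat) (k : 'I_J) : (0 < p)%N -> grid_size D p eta J ->
  0 <= grid_pt p eta k.+1 /\ grid_pt p eta k.+1 + p%:R <= D%:R.
Proof.
move=> p0 [J0 /andP[_ JD]]; have p0R : 0 < p%:R * eta by rewrite mulr_gt0 ?ltr0n.
rewrite /grid_pt -!mulrA; split.
  by rewrite mulr_ge0 ?(ltW p0R)// subr_ge0 ler1n.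
rewrite -lerBrDr (le_trans _ JD)// /grid_pt -!mulrA ler_wpM2r ?(ltW p0R)//.
by rewrite lerD2r ler_nat.
Qed.

(** The threshold satisfies [(K * L)%:R * expR (- H ^+ 2 / 2) = 1], so the union bound leaves
    exactly the second factor of [gaussian_tail]. *)
Lemma scan_test_type1 (J : nat) : (0 < J)%N ->
  (type1 xi (@scan_test R N M n m eta K L) <=
   (expR 1 / J%:R + expR (- H / J%:R))%R%:E)%E.
Proof.
move=> J0.
have KL0 : 0 < (K * L)%:R :> R by rewrite ltr0n muln_gt0 gK.1 gL.1.
have KL1 : 1 <= (K * L)%:R :> R by rewrite ler1n muln_gt0 gK.1 gL.1.
pose V (k : 'I_K) (l : 'I_L) :=
  block_dir (grid_pt n eta k.+1) (grid_pt m eta l.+1).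
have mV k l : mx_measurable (fun Y => (H < frob (V k l) Y)%R%:R).
  by apply: mx_measurable_lt; [exact: mx_measurable_cst|exact: mx_measurable_frob].
apply: (@le_trans _ _ (expect xi 0 (fun Y =>
    \sum_(k < K) \sum_(l < L) (H < frob (V k l) Y)%R%:R)%R)).
  apply: expect_le.
  - exact: mx_measurable_scan_test.
  - by apply: mx_measurable_sum => k; apply: mx_measurable_sum => l.
  move=> Y; rewrite scan_testE; case: (boolP (_ <= _)%E) => [_|] /=.
    by rewrite lexx sumr_ge0// => k _; rewrite sumr_ge0.
  rewrite ler01 => /scan_leP.
  move=> /existsNP[k /existsNP[l /negP]]; rewrite -ltNge block_statE => Hkl.
  rewrite (bigD1 k)//= (bigD1 l)//= Hkl -addrA lerDl addr_ge0// sumr_ge0// => k' _.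
  by rewrite sumr_ge0.
rewrite expect_sum//; first last.
- by move=> k Y; rewrite sumr_ge0.
- by move=> k; apply: mx_measurable_sum => l.
pose b := expR (- H ^+ 2 / 2) * (expR 1 / J%:R + expR (- H / J%:R)).
apply: (@le_trans _ _ (\sum_(k < K) \sum_(l < L) b%:E)%E).
  apply: lee_sum => k _; rewrite expect_sum//.
  apply: lee_sum => l _; apply: gaussian_tail => //.
  have [x0 xN] := grid_pt_range k n0 gK.
  have [y0 yM] := grid_pt_range l m0 gL.
  exact: frob_block_dir.
have -> : (\sum_(k < K) \sum_(l < L) b%:E = ((K * L)%:R * b)%R%:E)%E.
  under eq_bigr do rewrite sumEFin.
  rewrite sumEFin; congr EFin; rewrite mulr_natl mulrnA mulrnAC.
  by rewrite !sumr_const !card_ord.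
rewrite lee_fin /b mulrA ler_piMl ?addr_ge0 ?divr_ge0 ?expR_ge0//.
rewrite mulNr sqr_sqrtr ?mulr_ge0 ?ln_ge0//.
rewrite mulrAC divff ?pnatr_eq0// mul1r -lnV ?posrE//.
by rewrite lnK ?posrE ?invr_gt0// mulfV// gt_eqF.
Qed.

(** One grid block close to the support of the signal suffices: its statistic has mean at least
    [a * r * D], and a Chernoff bound with exponent 1 controls the event that it stays below [H].
    The summand [2^-1] is the log-moment of a standard normal variable at -1. *)
Lemma scan_test_miss (S : 'M[R]_(N, M)) (a : R) : 0 < a ->
  n%:R^-1 + eta <= 1 -> m%:R^-1 + eta <= 1 -> signals n m a S ->
  (expect xi S (fun Y => 1 - scan_test n m eta K L Y)%R <=
   (expR (2^-1 + H - a * r * ((1 - n%:R^-1 - eta) * (1 - m%:R^-1 - eta))))%R%:E)%E.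
Proof.
move=> a0 ne me [k [l [kN lM Skl]]].
have [c /andP[c1 cK] [x0 xk]] := grid_cover n0 eta0 gK kN.
have [c' /andP[c'1 c'L] [y0 yl]] := grid_cover m0 eta0 gL lM.
set D := (1 - n%:R^-1 - eta) * (1 - m%:R^-1 - eta).
pose x : R := grid_pt n eta c; pose y : R := grid_pt m eta c'.
pose V := block_dir x y.
have xN : x + n%:R <= N%:R.
  have /andP[xk' _] := xk.
  by rewrite (le_trans (y := k%:R + n%:R))// ?lerD2r// -natrD ler_nat.
have yM : y + m%:R <= M%:R.
  have /andP[yl' _] := yl.
  by rewrite (le_trans (y := l%:R + m%:R))// ?lerD2r// -natrD ler_nat.
have V1 : frob V V = 1 by exact: frob_block_dir.
(* Entries of [S] are at least [a] on the overlap and 0 on the rest of the grid block, so the sum is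
   at least [a] times the size of the overlap. *)
have VS : a * r * D <= frob V S.
  rewrite frobZl frob_ind.
  have := card_block_overlap x0 y0 kN lM xk yl (ltW eta0) n0 m0 ne me.
  set E := block N M n m k%:R _; set A := block N M n m x y => cD.
  have nmr : n%:R * m%:R = r * r by rewrite -expr2 sqr_sqrtr ?natrM// ltW// -natrM.
  rewrite -(ler_pM2l r0) [leRHS]mulrA mulfV ?gt_eqF// mul1r.
  apply: (@le_trans _ _ (a * #|A :&: E|%:R)).
    by rewrite mulrCA -!mulrA ler_pM2l// mulrA -nmr.
  rewrite -frob_ind_ind frob_ind mulr_sumr; apply: ler_sum => -[i j] _ /=.
  rewrite mxE; have [S0 Sa] := Skl i j.
  by case: (boolP (_ \in E)) => [/Sa|/S0 ->]; rewrite ?mulr1 ?mulr0.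
have mscan : mx_measurable (fun Y : 'M[R]_(N, M) => 1 - scan_test n m eta K L Y).
  apply: (@mx_measurableB _ _ _ (fun=> 1)); first exact: mx_measurable_cst.
  exact: mx_measurable_scan_test.
rewrite -[S]add0r expectD.
apply: (@le_trans _ _ (expect xi 0 (fun Y =>
    (expR (H - frob V S) * expR (frob (- V) Y))%R))).
  apply: expect_le.
  - exact: (mx_measurable_shift S mscan).
  - apply: mx_measurableM; first exact: mx_measurable_cst.
    by apply: mx_measurable_exp; exact: mx_measurable_frob.
  move=> Y; rewrite scan_testE; case: (boolP (_ <= _)%E) => /=; last first.
    by move=> _; rewrite subrr lexx mulr_ge0 ?expR_ge0.
  rewrite subr0 ler01 => /scan_leP YH.
  have c1K : (c.-1 < K)%N by rewrite prednK.
  have c1L : (c'.-1 < L)%N by rewrite prednK.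
  have := YH (Ordinal c1K) (Ordinal c1L); rewrite /= !prednK// block_statE.
  rewrite -/V frobDr -expRD => VH; rewrite -[leLHS]expR0 ler_expR.
  by rewrite frobNl; lra.
rewrite expectZ ?expR_ge0//; last first.
  by apply: mx_measurable_exp; exact: mx_measurable_frob.
rewrite expect_expR// frobNl (frobC V (- V)) frobNl V1 opprK -EFinM -expRD lee_fin ler_expR.
lra.
Qed.

End scan_test.

(** * Total error of the scan test *)

Section scan_error.
Context (R : realType) (d : measure_display) (T : measurableType d)
  (P : probability T R) (N M : nat) (xi : 'I_N -> 'I_M -> {RV P >-> R}).

Lemma signals_block (n m k l : nat) (a : R) : (k + n <= N)%N -> (l + m <= M)%N ->
  signals n m a (a *: ind_mx R (block N M n m (k%:R : R) l%:R)).
Proof.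
move=> kN lM; exists k, l; split => // i j; split => [/negbTE|] ijE.
  by rewrite !mxE ijE mulr0.
by rewrite !mxE ijE mulr1.
Qed.

Lemma total_error_ge0 n m (a : R) (psi : 'M[R]_(N, M) -> R) :
  (n <= N)%N -> (m <= M)%N -> is_test psi ->
  (0 <= total_error xi n m a psi)%E.
Proof.
move=> nN mM [mpsi psi01]; apply: adde_ge0.
  by apply: expect_ge0 => Y; have /andP[] := psi01 Y.
(* The supremum of an empty set would be [-oo]; this corner block provides a member. *)
pose S0 := a *: ind_mx R (block N M n m (0%:R : R) 0%:R).
apply: (@le_trans _ _ (expect xi S0 (fun Y => (1 - psi Y)%R))).
  by apply: expect_ge0 => Y; rewrite subr_ge0; have /andP[] := psi01 Y.
by apply: ereal_sup_ubound => /=; exists S0 => //; exact: signals_block.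
Qed.

Hypothesis xi_iid : iid_std_normal xi.

Lemma scan_test_total_error n m (eta a : R) K L (J : nat)
    (H := Num.sqrt (2 * ln (K * L)%:R) : R) :
  (0 < n <= N)%N -> (0 < m <= M)%N -> 0 < eta -> 0 < a ->
  n%:R^-1 + eta <= 1 -> m%:R^-1 + eta <= 1 ->
  grid_size N n eta K -> grid_size M m eta L -> (0 < J)%N ->
  (0 <= total_error xi n m a (scan_test n m eta K L) <=
   (expR 1 / J%:R + expR (- H / J%:R) + expR (2^-1 + H -
    a * Num.sqrt (n * m)%:R *
      ((1 - n%:R^-1 - eta) * (1 - m%:R^-1 - eta))))%R%:E)%E.
Proof.
move=> /andP[n0 nN] /andP[m0 mM] eta0 a0 ne me gK gL J0; apply/andP; split.
  by apply: total_error_ge0 => //; exact: is_test_scan_test.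
rewrite EFinD; apply: leeD; first exact: scan_test_type1.
apply: ge_ereal_sup => _ [S Ssig <-]; exact: scan_test_miss.
Qed.

End scan_error.

(** * Truncated second moment method for a mixture of orthogonal means *)

Section mixture.
Context (R : realType) (d : measure_display) (T : measurableType d)
  (P : probability T R) (N M : nat) (xi : 'I_N -> 'I_M -> {RV P >-> R}).
Hypothesis xi_iid : iid_std_normal xi.
Variables (I : finType) (S : I -> 'M[R]_(N, M)) (h2 s : R).
Hypotheses (I0 : (0 < #|I|)%N) (s01 : 0 <= s <= 1).
Hypothesis Sh : forall b, frob (S b) (S b) = h2.
Hypothesis S_orth : forall b c, b != c -> frob (S b) (S c) = 0.

Local Notation k := (#|I|%:R : R).

(* [k ^ (- s) * E (lr (S b)) ^ (1 + s)] *)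
Definition moment_bound : R :=
  expR (- s * ln k + (1 + s) * s * h2 / 2).

Local Notation rho := moment_bound.

Let k0 : 0 < k. Proof. by rewrite ltr0n. Qed.

Let rho0 : 0 <= rho. Proof. exact: expR_ge0. Qed.

(** This is [lr (S b)] to the power [1 + s], normalised to expectation 1: again a likelihood
    ratio. *)
Let tilt b Y := lr ((1 + s) *: S b) Y.
Let trunc b Y := Num.min (lr (S b) Y) k.

Let tilt_ge0 b Y : 0 <= tilt b Y. Proof. exact: expR_ge0. Qed.
Let lr_ge0 b Y : 0 <= lr (S b) Y. Proof. exact: expR_ge0. Qed.
Let trunc_ge0 b Y : 0 <= trunc b Y.
Proof. by rewrite le_min lr_ge0 ltW. Qed.

Let m_tilt b : mx_measurable (tilt b). Proof. exact: mx_measurable_lr. Qed.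
Let m_lr b : mx_measurable (lr (S b)). Proof. exact: mx_measurable_lr. Qed.
Let m_trunc b : mx_measurable (trunc b).
Proof. by apply: mx_measurable_min => //; exact: mx_measurable_cst. Qed.

(** The right-hand side is [k ^ (- s) * X ^ (1 + s)] with [X] for [lr (S b) Y]; it dominates both
    truncation errors below. *)
Let tiltE b Y : rho * tilt b Y =
  expR (- s * ln k + (1 + s) * (frob (S b) Y - h2 / 2)).
Proof.
by rewrite /tilt lrE frobZl frobZl frobZr Sh -expRD; congr (expR _); field.
Qed.

(** Where [X = lr (S b) Y] exceeds [k], it is at most [X * (X / k) ^ s]. *)
Let lr_le_trunc b Y : lr (S b) Y <= trunc b Y + rho * tilt b Y.
Proof.
rewrite tiltE /trunc lrE Sh; set u := _ - _.
have /andP[s0 s1] := s01.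
have [uk|ku] := leP u (ln k).
  have -> : Num.min (expR u) k = expR u.
    by apply: min_l; rewrite -(lnK k0) ler_expR.
  by rewrite lerDl expR_ge0.
apply: ler_wpDl; first by rewrite le_min expR_ge0 ltW.
by rewrite ler_expR; nra.
Qed.

(** Interpolation: the square of [min X k] is at most [k ^ (1 - s) * X ^ (1 + s)], as
    [0 <= s <= 1]. *)
Let trunc_sqr_le b Y : trunc b Y ^+ 2 <= k * rho * tilt b Y.
Proof.
rewrite -mulrA tiltE /trunc lrE Sh; set u := _ - _.
have /andP[s0 s1] := s01.
rewrite -[X in _ <= X * _](lnK k0) -expRD.
have [uk|ku] := leP u (ln k).
  rewrite (_ : Num.min _ _ = expR u); last first.
    by apply: min_l; rewrite -(lnK k0) ler_expR.
  by rewrite expr2 -expRD ler_expR; nra.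
rewrite (_ : Num.min _ _ = expR (ln k)); last first.
  by rewrite lnK//; apply: min_r; rewrite -[leLHS](lnK k0) ler_expR ltW.
by rewrite expr2 -expRD ler_expR; nra.
Qed.

Let mix (Y : 'M[R]_(N, M)) : R := k^-1 * \sum_b trunc b Y.

Let mix_ge0 Y : 0 <= mix Y.
Proof. by rewrite mulr_ge0 ?invr_ge0 ?(ltW k0)// sumr_ge0. Qed.

Let m_mix : mx_measurable mix.
Proof.
apply: mx_measurableM; first exact: mx_measurable_cst.
exact: mx_measurable_sum.
Qed.

(** Dominates [trunc p.1 * trunc p.2]: truncation is exploited on the diagonal and dropped off it,
    where orthogonality already gives expectation 1. *)
Let pair_bound (p : I * I) Y : R :=
  if p.1 == p.2 then k * rho * tilt p.1 Y else lr (S p.1) Y * lr (S p.2) Y.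

Let m_pair_bound p : mx_measurable (pair_bound p).
Proof.
rewrite /pair_bound; case: (p.1 == p.2); last exact: mx_measurableM.
by apply: mx_measurableM => //; exact: mx_measurable_cst.
Qed.

Let pair_bound_ge0 p Y : 0 <= pair_bound p Y.
Proof. by rewrite /pair_bound; case: ifP => _; rewrite !mulr_ge0// ltW. Qed.

Let mix_sqr_le Y : mix Y ^+ 2 <= (k ^+ 2)^-1 * \sum_p pair_bound p Y.
Proof.
rewrite exprMn exprVn ler_wpM2l ?invr_ge0 ?sqr_ge0// expr2 big_distrlr /=.
rewrite pair_big /=; apply: ler_sum => -[b c] _ /=; rewrite /pair_bound /=.
case: eqP => [->|_]; first by rewrite -expr2.
by rewrite ler_pM// ge_min lexx.
Qed.

Let expect_pair_bound :
  expect xi 0 (fun Y => (k ^+ 2)^-1 * \sum_p pair_bound p Y) =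
  ((k ^+ 2)^-1 * \sum_p (if p.1 == p.2 :> I then k * rho else 1))%:E.
Proof.
rewrite expectZ ?invr_ge0 ?sqr_ge0//; last 2 first.
- exact: mx_measurable_sum.
- by move=> Y; rewrite sumr_ge0.
rewrite EFinM expect_sum// -sumEFin; congr (_ * _)%E.
apply: eq_bigr => p _; rewrite /pair_bound.
case: (eqVneq p.1 p.2) => [_|bc].
  by rewrite expectZ ?mulr_ge0 ?(ltW k0)// expect_lr// mule1.
by rewrite expect_lrM// S_orth// expR0.
Qed.

Let sum_pair_le :
  (k ^+ 2)^-1 * \sum_(p : I * I) (if p.1 == p.2 then k * rho else 1) <= 1 + rho.
Proof.
rewrite -(pair_big xpredT xpredT
  (fun b c : I => if b == c then k * rho else 1)) /=.
rewrite ler_pdivrMl ?exprn_gt0//.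
apply: (@le_trans _ _ (\sum_(b : I) (k * rho + k))).
  apply: ler_sum => b _; rewrite (bigD1 b)//= eqxx lerD2l.
  rewrite (eq_bigr (fun=> 1)) => [|c /negbTE]; last by rewrite eq_sym => ->.
  by rewrite sumr_const ler_nat max_card.
by rewrite sumr_const -mulr_natl; nra.
Qed.

(** Stated for arbitrary [V] because it serves both [S] and its tilted version. *)
Let expect_mix (V : I -> 'M[R]_(N, M)) :
  expect xi 0 (fun Y => k^-1 * \sum_b lr (V b) Y) = 1%E.
Proof.
have mV b : mx_measurable (lr (V b)) by exact: mx_measurable_lr.
have V0 b Y : 0 <= lr (V b) Y by exact: expR_ge0.
rewrite expectZ ?invr_ge0 ?(ltW k0)//; last 2 first.
- exact: mx_measurable_sum.
- by move=> Y; rewrite sumr_ge0.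
rewrite expect_sum//; under eq_bigr do rewrite expect_lr//.
by rewrite sumEFin sumr_const -EFinM mulVf// gt_eqF.
Qed.

(* Minorises [min 1 x] by a quadratic polynomial that is [1 - e] at [x = 1], so
   that two moments suffice. *)
Let min1_ge (e x : R) : 0 < e -> 0 <= x ->
  (1 + 2 * (4 * e)^-1) * x <=
  Num.min 1 x + (4 * e)^-1 * x ^+ 2 + ((4 * e)^-1 + e).
Proof.
move=> e0 x0; set C := (4 * e)^-1.
have C0 : 0 < C by rewrite invr_gt0 mulr_gt0.
have Ce : 4 * e * C = 1 by rewrite /C mulfV// gt_eqF// mulr_gt0.
have [x1|x1] := leP x 1; first by nra.
(* For [x > 1] this square is the difference of the two sides; [4 * e * C = 1] is what makes the
   quadratic have zero discriminant. *)
suff : 0 <= C * (x - 1 - 2 * e) ^+ 2 by nra.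
by rewrite mulr_ge0 ?sqr_ge0// ltW.
Qed.

(** Apply [min1_ge] to [mix], whose mean is at least [1 - rho] by [lr_le_trunc] and whose second
    moment is at most [1 + rho]. *)
Lemma expect_min_mix (e : R) : 0 < e ->
  ((1 - rho - 3 * (4 * e)^-1 * rho - e)%:E <=
   expect xi 0 (fun Y => Num.min 1%R (mix Y)))%E.
Proof.
move=> e0; set C := (4 * e)^-1.
have C0 : 0 < C by rewrite invr_gt0 mulr_gt0.
set E := expect _ _ _.
have mmin : mx_measurable (fun Y => Num.min 1 (mix Y)).
  by apply: mx_measurable_min => //; exact: mx_measurable_cst.
have min01 Y : 0 <= Num.min 1 (mix Y) <= 1.
  by rewrite le_min ler01 mix_ge0 ge_min lexx.
have E_fin : E \is a fin_num 
  by apply: (@expect_fin_num _ _ _ _ _ _ _ _ 1).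
(* The inequality to integrate is [f1 <= g1 + g2 + g3 + (C + e)], arranged so that every term is
   nonnegative and the expectation rules apply. *)
pose f1 Y := (1 + 2 * C) * (k^-1 * \sum_b lr (S b) Y).
pose g1 Y := Num.min 1 (mix Y).
pose g2 Y := C * ((k ^+ 2)^-1 * \sum_p pair_bound p Y).
pose g3 Y := (1 + 2 * C) * rho * (k^-1 * \sum_b tilt b Y).
have m_sumlr : mx_measurable (fun Y => k^-1 * \sum_b lr (S b) Y).
  apply: mx_measurableM; first exact: mx_measurable_cst.
  exact: mx_measurable_sum.
have m_sumtilt : mx_measurable (fun Y => k^-1 * \sum_b tilt b Y).
  apply: mx_measurableM; first exact: mx_measurable_cst.
  exact: mx_measurable_sum.
have m_sumpair : mx_measurable (fun Y => (k ^+ 2)^-1 * \sum_p pair_bound p Y).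
  apply: mx_measurableM; first exact: mx_measurable_cst.
  exact: mx_measurable_sum.
have sumlr0 Y : 0 <= k^-1 * \sum_b lr (S b) Y.
  by rewrite mulr_ge0 ?invr_ge0 ?(ltW k0)// sumr_ge0.
have sumtilt0 Y : 0 <= k^-1 * \sum_b tilt b Y.
  by rewrite mulr_ge0 ?invr_ge0 ?(ltW k0)// sumr_ge0.
have sumpair0 Y : 0 <= (k ^+ 2)^-1 * \sum_p pair_bound p Y.
  by rewrite mulr_ge0 ?invr_ge0 ?sqr_ge0// sumr_ge0.
have c0 : 0 <= 1 + 2 * C by rewrite addr_ge0// mulr_ge0// ltW.
have mf1 : mx_measurable f1.
  by apply: mx_measurableM => //; exact: mx_measurable_cst.
have mg2 : mx_measurable g2.
  by apply: mx_measurableM => //; exact: mx_measurable_cst.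
have mg3 : mx_measurable g3.
  by apply: mx_measurableM => //; exact: mx_measurable_cst.
have g10 Y : 0 <= g1 Y by have /andP[] := min01 Y.
have g20 Y : 0 <= g2 Y by rewrite mulr_ge0// ltW.
have g30 Y : 0 <= g3 Y by apply: mulr_ge0 => //; exact: mulr_ge0.
have mgc : mx_measurable (fun Y : 'M[R]_(N, M) => C + e).
  exact: mx_measurable_cst.
have fg Y : 0 <= f1 Y <= g1 Y + (g2 Y + (g3 Y + (C + e))).
  rewrite /f1 mulr_ge0//=.
  have h1 : k^-1 * \sum_b lr (S b) Y <= mix Y + rho * (k^-1 * \sum_b tilt b Y).
    rewrite mulrCA -mulrDr ler_wpM2l ?invr_ge0 ?(ltW k0)// mulr_sumr -big_split.
    by apply: ler_sum => b _; exact: lr_le_trunc.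
  have := min1_ge e0 (mix_ge0 Y); rewrite -/C => h2'.
  have := mix_sqr_le Y => h3.
  have h3' : C * mix Y ^+ 2 <= g2 Y by rewrite ler_wpM2l// ltW.
  have h1' : (1 + 2 * C) * (k^-1 * \sum_b lr (S b) Y) <=
      (1 + 2 * C) * mix Y + g3 Y.
    by rewrite /g3 -mulrA -mulrDr ler_wpM2l.
  rewrite /g1; lra.
have mg3c : mx_measurable (fun Y => g3 Y + (C + e)) by exact: mx_measurableD.
have mg23c : mx_measurable (fun Y => g2 Y + (g3 Y + (C + e))).
  exact: mx_measurableD.
have Ce0 : 0 <= C + e by rewrite addr_ge0 ?ltW.
have : (expect xi 0 f1 <=
    expect xi 0 (fun Y => (g1 Y + (g2 Y + (g3 Y + (C + e))))%R))%E.
  by apply: expect_le => //; exact: mx_measurableD.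
have g3c0 Y : 0 <= g3 Y + (C + e) by apply: addr_ge0.
have g23c0 Y : 0 <= g2 Y + (g3 Y + (C + e)) by apply: addr_ge0.
rewrite expect_add// expect_add//.
have -> : expect xi 0 f1 = (1 + 2 * C)%:E.
  by rewrite expectZ// expect_mix mule1.
have -> : expect xi 0 g2 = (C * ((k ^+ 2)^-1 *
    \sum_(p : I * I) (if p.1 == p.2 then k * rho else 1)))%:E.
  by rewrite expectZ// ?(ltW C0)// expect_pair_bound.
rewrite expect_add// expect_cst.
have -> : expect xi 0 g3 = ((1 + 2 * C) * rho)%:E.
  by rewrite expectZ// ?mulr_ge0// (expect_mix (fun b => (1 + s) *: S b)) mule1.
rewrite -[expect xi 0 g1]/E -(fineK E_fin) -!EFinD !lee_fin.
have := ler_wpM2l (ltW C0) sum_pair_le; set q := C * (_ * _); lra.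
Qed.

(** With [l] the averaged likelihood ratio, the type I error plus the average type II error is the
    null expectation of [psi + (1 - psi) * l], a convex combination of 1 and [l], hence at least
    [min 1 l]; truncation only decreases [l]. *)
Lemma orthogonal_mixture_bound (psi : 'M[R]_(N, M) -> R) (t e : R) :
  is_test psi -> 0 < e ->
  (forall b, expect xi (S b) (fun Y => (1 - psi Y)%R) <= t%:E)%E ->
  ((1 - rho - 3 * (4 * e)^-1 * rho - e)%:E <= expect xi 0 psi + t%:E)%E.
Proof.
move=> [mpsi psi01] e0 psi_t; apply: (le_trans (expect_min_mix e0)).
have psi0 Y : 0 <= psi Y by have /andP[] := psi01 Y.
have cpsi0 Y : 0 <= 1 - psi Y by rewrite subr_ge0; have /andP[] := psi01 Y.
have mcpsi : mx_measurable (fun Y => 1 - psi Y).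
  by apply: mx_measurableB => //; exact: mx_measurable_cst.
have mb b : mx_measurable (fun Y => (1 - psi Y) * lr (S b) Y).
  exact: mx_measurableM.
have b0 b Y : 0 <= (1 - psi Y) * lr (S b) Y by rewrite mulr_ge0.
have ms : mx_measurable (fun Y => \sum_b (1 - psi Y) * lr (S b) Y).
  exact: mx_measurable_sum.
have mks : mx_measurable (fun Y => k^-1 * \sum_b (1 - psi Y) * lr (S b) Y).
  by apply: mx_measurableM => //; exact: mx_measurable_cst.
have kV0 : 0 <= k^-1 by rewrite invr_ge0 ltW.
apply: (@le_trans _ _ (expect xi 0 (fun Y =>
    (psi Y + k^-1 * \sum_b (1 - psi Y) * lr (S b) Y)%R))).
  apply: expect_le.
  - by apply: mx_measurable_min => //; exact: mx_measurable_cst.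
  - exact: mx_measurableD.
  move=> Y; rewrite le_min ler01 mix_ge0 /= -mulr_sumr mulrCA.
  have mixle : mix Y <= k^-1 * \sum_b lr (S b) Y.
    rewrite ler_wpM2l//; apply: ler_sum => b _.
    by rewrite /trunc ge_min lexx.
  have := cpsi0 Y; have := psi0 Y; have := mix_ge0 Y; move: mixle.
  set x := mix Y; set y := k^-1 * _ => xy x0 p0 p1.
  have : (1 - psi Y) * x <= (1 - psi Y) * y by rewrite ler_wpM2l.
  by have [x1|x1] := leP x 1 => h; nra.
rewrite expect_add//; last by move=> Y; rewrite mulr_ge0// sumr_ge0.
apply: leeD2l; rewrite expectZ//; last by move=> Y; rewrite sumr_ge0.
rewrite expect_sum//.
apply: (@le_trans _ _ (k^-1%R%:E * \sum_(b : I) t%:E)%E).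
  apply: lee_wpmul2l; first by rewrite lee_fin.
  by apply: lee_sum => b _; rewrite -cameron_martin.
by rewrite sumEFin sumr_const -EFinM lee_fin -[t *+ _]mulr_natl mulrA mulVf ?gt_eqF// mul1r.
Qed.

End mixture.

(** * Margins from upper and lower limits, and convergence in the extended reals *)

Section ereal_limits.
Context (R : realType) (T : choiceType) (I : filteredType T).
Context (F : set_system I) (FF : Filter F).
Implicit Types f : I -> \bar R.

(** Turns the strict condition on the signal ratio into a fixed margin that holds eventually. *)
Lemma lt_limf_einf f (x : R) : (x%:E < limf_einf f F)%E ->
  exists2 c : R, x < c & \forall i \near F, (c%:E <= f i)%E.
Proof.
rewrite limf_einfE => /ereal_sup_gt[_ [V FV <-]] xV.
have [c xc cV] : exists2 c : R, x < c & (c%:E <= ereal_inf (f @` V))%E.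
  move: xV; case: (ereal_inf _) => [r| |] //.
    by rewrite lte_fin => xr; exists r.
  by exists (x + 1); [rewrite ltrDl|rewrite leey].
exists c => //; apply: filterS FV => i Vi.
by apply: (le_trans cV); apply: ereal_inf_lbound; exists i.
Qed.

Lemma limf_esup_lt f (x : R) : (limf_esup f F < x%:E)%E ->
  exists2 c : R, c < x & \forall i \near F, (f i <= c%:E)%E.
Proof.
rewrite limf_esupE => /ereal_inf_lt[_ [V FV <-]] xV.
have [c xc cV] : exists2 c : R, c < x & (ereal_sup (f @` V) <= c%:E)%E.
  move: xV; case: (ereal_sup _) => [r| |] //.
    by rewrite lte_fin => xr; exists r.
  by exists (x - 1); [rewrite gtrBl|rewrite leNye].
exists c => //; apply: filterS FV => i Vi.
by apply: le_trans cV; apply: ereal_sup_ubound; exists i.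
Qed.

Lemma cvge_near f (l : R) :
  (forall e : R, 0 < e ->
    \forall i \near F, ((l - e)%:E <= f i <= (l + e)%:E)%E) ->
  f i @[i --> F] --> l%:E.
Proof.
move=> fl; have fin i (e : R) : ((l - e)%:E <= f i <= (l + e)%:E)%E ->
    f i \is a fin_num /\ `|l - fine (f i)| <= e.
  case: (f i) => [r| |] //=; rewrite ?leye_eq ?leeNy_eq ?andbF//.
  by rewrite !lee_fin ler_norml => /andP[h1 h2]; split => //; lra.
apply/fine_cvgP; split.
  by have := fl 1 ltr01; apply: filterS => i /fin[].
apply/cvgrPdist_le => e e0; have := fl e e0; apply: filterS => i /fin[].
by [].
Qed.

End ereal_limits.

(** * Lower bound on the total error of any test, for fixed sizes *)

Section block_lower_bound.
Context (R : realType) (d : measure_display) (T : measurableType d)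
  (P : probability T R) (N M : nat) (xi : 'I_N -> 'I_M -> {RV P >-> R}).

Lemma is_test_cst (c : R) : 0 <= c <= 1 ->
  is_test (fun _ : 'M[R]_(N, M) => c).
Proof. by move=> c01; split => // Y; exact: measurable_cst. Qed.

Lemma type1_cst (c : R) : type1 xi (fun=> c) = c%:E.
Proof. exact: expect_cst. Qed.

Lemma type2_cst_le n m (a c : R) : (type2 xi n m a (fun=> c) <= (1 - c)%:E)%E.
Proof.
by apply: ge_ereal_sup => _ [S _ <-]; rewrite expect_cst.
Qed.

Variables (n m : nat) (a : R).
Hypotheses (n0 : (0 < n <= N)%N) (m0 : (0 < m <= M)%N).

Lemma type2_fin_num psi : is_test psi -> type2 xi n m a psi \is a fin_num.
Proof.
move=> [mpsi psi01]; have [/andP[_ nN] /andP[_ mM]] := (n0, m0).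
have mc : mx_measurable (fun Y => 1 - psi Y).
  by apply: (mx_measurableB _ mpsi); exact: mx_measurable_cst.
rewrite ge0_fin_numE.
  apply: (@le_lt_trans _ _ 1%E); last exact: ltry.
  apply: ge_ereal_sup => _ [S _ <-].
  rewrite -(expect_cst xi S 1); apply: expect_le => //.
    exact: mx_measurable_cst.
  by move=> Y; have /andP[h0 h1] := psi01 Y; rewrite subr_ge0 h1 gerBl.
pose S0 := a *: ind_mx R (block N M n m (0%:R : R) 0%:R).
apply: (@le_trans _ _ (expect xi S0 (fun Y => (1 - psi Y)%R))).
  by apply: expect_ge0 => Y; rewrite subr_ge0; have /andP[] := psi01 Y.
by apply: ereal_sup_ubound => /=; exists S0 => //; exact: signals_block.
Qed.

Hypothesis xi_iid : iid_std_normal xi.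

(** The mixture runs over the tiles with corners at multiples of [n] and [m]. Disjoint tiles give
    orthogonal mean matrices, each of squared norm [a ^+ 2 * n%:R * m%:R]. *)
Lemma total_error_lower (s e : R) psi
    (rho := expR (- s * ln ((N %/ n) * (M %/ m))%:R +
                  (1 + s) * s * (a ^+ 2 * n%:R * m%:R) / 2)) :
  0 <= s <= 1 -> 0 < e -> is_test psi ->
  ((1 - rho - 3 * (4 * e)^-1 * rho - e)%R%:E <= total_error xi n m a psi)%E.
Proof.
move=> s01 e0 tpsi.
have [/andP[n1 nN] /andP[m1 mM]] := (n0, m0).
pose I := ('I_(N %/ n) * 'I_(M %/ m))%type.
have cardI : #|{: I}| = (N %/ n * (M %/ m))%N by rewrite card_prod !card_ord.
have side (D p : nat) (k : 'I_(D %/ p)) : (k * p + p <= D)%N.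
  by rewrite -mulSnr (leq_trans _ (leq_divM D p))// leq_mul2r ltn_ord orbT.
pose E (b : I) := block N M n m ((b.1 * n)%N%:R : R) (b.2 * m)%N%:R.
pose S (b : I) : 'M[R]_(N, M) := a *: ind_mx R (E b).
have Ssig b : signals n m a (S b) by apply: signals_block; exact: side.
have Sh b : frob (S b) (S b) = a ^+ 2 * n%:R * m%:R.
  rewrite frobZl frobZr frob_ind_ind finset.setIid card_block//.
  - by rewrite natrM expr2 !mulrA.
  - by rewrite -natrD ler_nat side.
  - by rewrite -natrD ler_nat side.
have S_orth b c : b != c -> frob (S b) (S c) = 0.
  move=> bc; rewrite frobZl frobZr frob_ind_ind.
  suff -> : E b :&: E c = finset.set0 by rewrite cards0 !mulr0.
  (* An index lying in two tiles determines the same quotient by [p] for both, so distinct tiles are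
     disjoint. *)
  have same (p i k k' : nat) : (0 < p)%N -> (k * p <= i < k * p + p)%N ->
      (k' * p <= i < k' * p + p)%N -> k = k'.
    move=> p0 /andP[h1 h2] /andP[h3 h4].
    have : (k * p < k'.+1 * p)%N by rewrite mulSnr (leq_ltn_trans h1).
    have : (k' * p < k.+1 * p)%N by rewrite mulSnr (leq_ltn_trans h3).
    by rewrite !ltn_pmul2r// !ltnS => h5 h6; apply/eqP; rewrite eqn_leq h6.
  apply/setP => -[i j]; rewrite /E !block_nat// !natrK !inE /=.
  apply/negbTE/negP => /andP[/andP[i1 j1] /andP[i2 j2]].
  case/eqP: bc; case: b c i1 j1 i2 j2 => [b1 b2] [c1 c2] /= i1 j1 i2 j2.
  by congr (_, _); apply: val_inj; [exact: same i1 i2|exact: same j1 j2].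
have cardI0 : (0 < #|{: I}|)%N by rewrite cardI muln_gt0 !divn_gt0// nN.
have t2_fin := type2_fin_num tpsi.
rewrite /total_error -(fineK t2_fin).
have := @orthogonal_mixture_bound _ _ _ _ _ _ _ xi_iid I S _ s cardI0 s01 Sh
  S_orth psi (fine (type2 xi n m a psi)) e tpsi e0.
rewrite /moment_bound cardI; apply => b; rewrite fineK//.
by apply: ereal_sup_ubound => /=; exists (S b).
Qed.

End block_lower_bound.

(** * Explicit comparisons with the logarithmic rate *)

Section rates.
Context (R : realType).
Implicit Types (N M n m K L : nat) (a eta : R).

Definition log_rate N M n m : R :=
  ln (n%:R / N%:R)^-1 + ln (m%:R / M%:R)^-1.

Let ratio_gt0 N n : (0 < n <= N)%N -> 0 < (n%:R / N%:R)^-1 :> R.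
Proof.
move=> /andP[n0 nN]; rewrite invr_gt0 divr_gt0 ?ltr0n//.
exact: leq_trans nN.
Qed.

Lemma ln_ratio_ge0 N n : (0 < n <= N)%N -> 0 <= ln (n%:R / N%:R)^-1 :> R.
Proof.
move=> /andP[n0 nN]; have N0 := leq_trans n0 nN.
by rewrite ln_ge0// invf_div ler_pdivlMr ?ltr0n// mul1r ler_nat.
Qed.

Lemma ln_ratioE N M n m : (0 < n <= N)%N -> (0 < m <= M)%N ->
  ln ((n%:R / N%:R) * (m%:R / M%:R)) = - log_rate N M n m.
Proof.
move=> n0 m0; have := ratio_gt0 n0; have := ratio_gt0 m0; rewrite !invr_gt0 => q0 p0.
by rewrite /log_rate !lnV ?posrE// lnM ?posrE// opprD !opprK.
Qed.

(** The quotient is at least 1, so rounding down loses at most a factor 2. *)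
Lemma ln_divn_ge N n : (0 < n <= N)%N ->
  ln (n%:R / N%:R)^-1 - ln 2 <= ln (N %/ n)%:R :> R.
Proof.
move=> /andP[n0 nN]; have N0 := leq_trans n0 nN.
have d0 : (0 < N %/ n)%N by rewrite divn_gt0.
have n0R : 0 < n%:R :> R by rewrite ltr0n.
rewrite lerBlDr -lnM ?posrE ?ltr0n// ler_ln ?posrE ?ratio_gt0 ?n0//; last first.
  by rewrite mulr_gt0// ltr0n.
rewrite invf_div ler_pdivrMr// -!natrM ler_nat.
by have := ltn_ceil N n0; nia.
Qed.

(** Up to the rounding term [2 * ln 2], the exponent is at most [- s * (1 - (1 + s) * c)] times the
    rate; with [s = 1 - c] this coefficient is [- s ^+ 3]. *)
Lemma moment_bound_le N M n m a (c : R) (s := 1 - c) :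
  (0 < n <= N)%N -> (0 < m <= M)%N -> 0 < c < 1 -> 0 < log_rate N M n m ->
  signal_ratio N M n m a <= c ->
  - s * ln ((N %/ n) * (M %/ m))%:R + (1 + s) * s * (a ^+ 2 * n%:R * m%:R) / 2
  <= 2 * ln 2 - s ^+ 3 * log_rate N M n m.
Proof.
move=> n0 m0 /andP[c0 c1] lam0.
rewrite /signal_ratio -/(log_rate N M n m) ler_pdivrMr ?mulr_gt0//.
have := ln_divn_ge n0; have := ln_divn_ge m0.
have [/andP[n1 nN] /andP[m1 mM]] := (n0, m0).
rewrite natrM lnM ?posrE ?ltr0n ?divn_gt0//.
set B1 := ln (M %/ m)%:R; set B2 := ln (N %/ n)%:R.
set lam := log_rate N M n m; set h := _ * m%:R => hB1 hB2 hc.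
have s0 : 0 < s by rewrite /s subr_gt0.
have s1 : s < 1 by rewrite /s gtrBl.
have l2 : 0 <= ln 2 :> R by rewrite ln_ge0// ler1n.
have hB : lam - 2 * ln 2 <= B2 + B1 by rewrite /lam /log_rate; lra.
have h1 : s * (lam - 2 * ln 2) <= s * (B2 + B1) by rewrite ler_wpM2l// ltW.
have h2 : (1 + s) * s * h <= (1 + s) * s * (c * (2 * lam)).
  by rewrite ler_wpM2l// mulr_ge0 ?(ltW s0)// addr_ge0// ltW.
have -> : 2 * ln 2 - s ^+ 3 * lam = - s * (lam - 2 * ln 2) +
    (1 + s) * s * (c * (2 * lam)) / 2 + 2 * (1 - s) * ln 2.
  by rewrite /s; field.
have : 0 <= 2 * (1 - s) * ln 2 by rewrite !mulr_ge0// subr_ge0 ltW.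
lra.
Qed.

Lemma grid_size_le N n eta K : (0 < n <= N)%N -> 0 < eta <= 1 ->
  grid_size N n eta K -> K%:R <= (n%:R / N%:R)^-1 * eta^-1 :> R.
Proof.
move=> /andP[n0 nN] /andP[e0 e1] [K0 /andP[_ KN]].
have n0R : 0 < n%:R :> R by rewrite ltr0n.
rewrite invf_div -mulrA -invfM ler_pdivlMr ?mulr_gt0//.
by move: KN; rewrite /grid_pt; nra.
Qed.

Lemma grid_size_ge N n eta K : (0 < n <= N)%N -> 0 < eta <= 1 ->
  grid_size N n eta K -> (n%:R / N%:R)^-1 - 1 <= K%:R :> R.
Proof.
move=> /andP[n0 nN] /andP[e0 e1] [K0 /andP[NK _]].
have n0R : 0 < n%:R :> R by rewrite ltr0n.
have K1 : 1 <= K%:R :> R by rewrite ler1n.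
rewrite invf_div lerBlDr ler_pdivrMr//.
move: NK; rewrite /grid_pt => NK.
have : n%:R * (K%:R * eta) <= n%:R * K%:R :> R by rewrite ler_wpM2l ?ler_piMr// ltW.
by nra.
Qed.

(** Each grid has at most [1 / (p * eta)], respectively [1 / (q * eta)], points. Hence
    [ln (K * L)%:R] is at most [1 + 2 * k] times the rate, and [1 + 2 * k <= (1 + k) ^+ 2]. *)
Lemma scan_threshold_le N M n m eta K L (k : R) :
  (0 < n <= N)%N -> (0 < m <= M)%N -> 0 < eta <= 1 ->
  grid_size N n eta K -> grid_size M m eta L -> 0 <= k ->
  `|ln eta| <= k * log_rate N M n m ->
  Num.sqrt (2 * ln (K * L)%:R) <=
  Num.sqrt (2 * log_rate N M n m) * (1 + k) :> R.
Proof.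
move=> n0 m0 e01 gK gL k0 lneta.
have KN := grid_size_le n0 e01 gK; have LM := grid_size_le m0 e01 gL.
have /andP[e0 e1] := e01.
have lam0 : 0 <= log_rate N M n m by rewrite addr_ge0 ?ln_ratio_ge0.
have lne : - ln eta <= `|ln eta| by rewrite -normrN ler_norm.
have KL : ln (K * L)%:R <= log_rate N M n m * (1 + 2 * k) :> R.
  rewrite natrM lnM ?posrE ?ltr0n ?gK.1 ?gL.1//.
  have hK : ln K%:R <= ln (n%:R / N%:R)^-1 - ln eta :> R.
    rewrite -lnV ?posrE// -lnM ?posrE ?ratio_gt0 ?invr_gt0//.
    by rewrite ler_ln ?posrE ?ltr0n ?gK.1 ?mulr_gt0 ?ratio_gt0 ?invr_gt0.
  have hL : ln L%:R <= ln (m%:R / M%:R)^-1 - ln eta :> R.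
    rewrite -lnV ?posrE// -lnM ?posrE ?ratio_gt0 ?invr_gt0//.
    by rewrite ler_ln ?posrE ?ltr0n ?gL.1 ?mulr_gt0 ?ratio_gt0 ?invr_gt0.
  by move: lneta; rewrite /log_rate in lam0 *; lra.
have k10 : 0 <= 1 + k by rewrite addr_ge0.
rewrite -[X in _ <= _ * X](ger0_norm k10) -sqrtr_sqr -sqrtrM ?mulr_ge0//.
rewrite ler_sqrt; last by rewrite !mulr_ge0// sqr_ge0.
by have := sqr_ge0 k; nra.
Qed.

Lemma signal_strength_ge N M n m a (c : R) : 0 < a -> 0 < log_rate N M n m ->
  0 <= c -> c <= signal_ratio N M n m a ->
  Num.sqrt (2 * log_rate N M n m) * Num.sqrt c <= a * Num.sqrt (n * m)%:R :> R.
Proof.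
move=> a0 lam0 c0.
rewrite /signal_ratio -/(log_rate N M n m) ler_pdivlMr ?mulr_gt0// => h.
rewrite -[X in _ <= X * _](ger0_norm (ltW a0)) -sqrtr_sqr -!sqrtrM ?sqr_ge0//.
  rewrite ler_sqrt ?mulr_ge0 ?sqr_ge0 ?(ltW a0)//.
  by rewrite natrM mulrA mulrC.
by rewrite mulr_ge0// ltW.
Qed.

(** Here [w] stands for the square root of twice the rate, [g] for [a] times the root of the block
    size, and [u], [v] for the inverse side lengths. Of the gap [w * (sc - 1)], a quarter is spent
    on the threshold and a quarter on imperfect overlap; the remaining half exceeds
    [2^-1 - ln e]. *)
Lemma detection_margin (sc e w g H u v : R) : 1 < sc -> 0 < e ->
  2 * `|2^-1 - ln e| / (sc - 1) <= w -> w * sc <= g ->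
  H <= w * (1 + (sc - 1) / 4) ->
  forall eta, u + eta <= (sc - 1) / (8 * sc) -> v + eta <= (sc - 1) / (8 * sc) ->
  expR (2^-1 + H - g * ((1 - u - eta) * (1 - v - eta))) <= e.
Proof.
move=> sc1 e0; rewrite ler_pdivrMr ?subr_gt0// => wt hg hH eta.
set dl := _ / (8 * sc) => ud vd; rewrite -[leRHS]lnK ?posrE// ler_expR.
have sc0 : 0 < sc := lt_trans ltr01 sc1.
have dl0 : 0 < dl by rewrite divr_gt0 ?subr_gt0// mulr_gt0.
have scdl : sc * (2 * dl) = (sc - 1) / 4.
  by rewrite /dl; field; rewrite gt_eqF.
have dl1 : dl < 2^-1 by rewrite ltr_pdivrMr ?mulr_gt0//; move: sc1; lra.
clearbody dl.
have w0 : 0 <= w.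
  rewrite -(pmulr_lge0 _ (_ : 0 < sc - 1)) ?subr_gt0//.
  by apply: le_trans wt; rewrite mulr_ge0.
have D2 : 1 - 2 * dl <= (1 - u - eta) * (1 - v - eta).
  apply: (@le_trans _ _ ((1 - dl) * (1 - dl))).
    by have := mulr_ge0 (ltW dl0) (ltW dl0); lra.
  by apply: ler_pM; move: dl1 ud vd; clear; lra.
have gD : w * (sc - (sc - 1) / 4) <= g * ((1 - u - eta) * (1 - v - eta)).
  apply: (@le_trans _ _ (w * sc * (1 - 2 * dl))).
    by rewrite -mulrA [sc * (1 - _)]mulrBr scdl mulr1.
  apply: (le_trans (ler_wpM2l _ D2)); first by rewrite mulr_ge0// ltW.
  by rewrite ler_wpM2r// (le_trans _ D2)//; move: dl1; clear; lra.
have := ler_norm (2^-1 - ln e); move: gD hH wt; clear.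
move: (g * _) (ln e) `|_| => gD l t; nra.
Qed.

End rates.

(** * Passage to the limit in both bounds *)

Section asymptotics.
Context (R : realType).
Context (n m : nat -> nat -> nat).
Hypothesis n_le : forall N M, (n N M <= N)%N.
Hypothesis m_le : forall N M, (m N M <= M)%N.
Hypothesis n_oo : n x.1 x.2 @[x --> NM_oo] --> \oo.
Hypothesis m_oo : m x.1 x.2 @[x --> NM_oo] --> \oo.
Hypothesis p_0 : ((n x.1 x.2)%:R / x.1%:R : R) @[x --> NM_oo] --> (0 : R).

Local Notation lam x := (log_rate R x.1 x.2 (n x.1 x.2) (m x.1 x.2)).

Lemma near_size_gt0 : \forall x \near NM_oo,
  (0 < n x.1 x.2 <= x.1)%N /\ (0 < m x.1 x.2 <= x.2)%N.
Proof.
near=> x; rewrite n_le m_le !andbT; split; near: x.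
- by have /cvgnyPge := n_oo; exact.
- by have /cvgnyPge := m_oo; exact.
Unshelve. all: by end_near. Qed.

Lemma near_ratio_ge (A : R) : \forall x \near NM_oo,
  A <= ((n x.1 x.2)%:R / x.1%:R)^-1.
Proof.
pose B := Num.max A 1.
have B0 : 0 < B by rewrite lt_max ltr01 orbT.
near=> x.
have [/andP[n0 nN] _] : (0 < n x.1 x.2 <= x.1)%N /\ (0 < m x.1 x.2 <= x.2)%N.
  by near: x; exact: near_size_gt0.
have p0 : 0 < (n x.1 x.2)%:R / x.1%:R :> R.
  by rewrite divr_gt0 ?ltr0n// (leq_trans n0).
have : `|(n x.1 x.2)%:R / x.1%:R| <= B^-1.
  by near: x; have /cvgr0Pnorm_le := p_0; apply; rewrite invr_gt0.
rewrite (ger0_norm (ltW p0)) => pB.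
apply: (@le_trans _ _ B); first by rewrite le_max lexx.
by rewrite -[B]invrK lef_pV2// posrE invr_gt0.
Unshelve. all: by end_near. Qed.

Lemma near_log_rate_ge (A : R) : \forall x \near NM_oo, A <= lam x.
Proof.
near=> x.
have [nx mx] : (0 < n x.1 x.2 <= x.1)%N /\ (0 < m x.1 x.2 <= x.2)%N.
  by near: x; exact: near_size_gt0.
have : expR A <= ((n x.1 x.2)%:R / x.1%:R)^-1 by near: x; exact: near_ratio_ge.
rewrite -[X in _ <= X]lnK; last first.
  rewrite posrE invr_gt0; have [/andP[n0 nN] _] := (nx, mx).
  by rewrite divr_gt0 ?ltr0n// (leq_trans n0).
rewrite ler_expR /log_rate => h.
by rewrite (le_trans h)// lerDl ln_ratio_ge0.
Unshelve. all: by end_near. Qed.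

Context (d : nat -> nat -> measure_display) (T : forall N M, measurableType (d N M))
  (P : forall N M, probability (T N M) R)
  (xi : forall N M, 'I_N -> 'I_M -> {RV (P N M) >-> R}).
Hypothesis xi_iid : forall N M, iid_std_normal (@xi N M).
Variable a : nat -> nat -> R.

Lemma near_total_error_ge (e : R) :
  (limf_esup (fun x : nat * nat =>
      (signal_ratio x.1 x.2 (n x.1 x.2) (m x.1 x.2) (a x.1 x.2))%:E)
      NM_oo < 1)%E -> 0 < e ->
  \forall x \near NM_oo, forall psi, is_test psi ->
    ((1 - e)%:E <=
     total_error (@xi x.1 x.2) (n x.1 x.2) (m x.1 x.2) (a x.1 x.2) psi)%E.
Proof.
move=> /limf_esup_lt[c' c'1 near_c'] e0.
(* The maximum makes [c] positive while keeping it below 1, so that [s] lies strictly between 0 and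
   1. *)
pose c := Num.max c' 2^-1.
have c0 : 0 < c by rewrite lt_max invr_gt0 ltr0n orbT.
have c1 : c < 1 by rewrite gt_max c'1 invf_lt1// ltr1n.
pose s := 1 - c; pose C : R := 3 * (4 * (e / 2))^-1.
have C0 : 0 < C by rewrite mulr_gt0// invr_gt0 mulr_gt0// divr_gt0.
(* One half of [e] is the parameter of [total_error_lower]; [rho <= r] keeps the other loss,
   [rho * (1 + C)], within the second half. *)
pose r := e / 2 / (1 + C).
have r0 : 0 < r by rewrite divr_gt0 ?divr_gt0// addr_gt0.
have s3 : 0 < s ^+ 3 by rewrite exprn_gt0// subr_gt0.
near=> x => psi tpsi.
have [nx mx] : (0 < n x.1 x.2 <= x.1)%N /\ (0 < m x.1 x.2 <= x.2)%N.
  by near: x; exact: near_size_gt0.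
have lam1 : 1 <= lam x by near: x; exact: near_log_rate_ge.
(* Brings the bound [2 * ln 2 - s ^+ 3 * lam x] on the exponent of [rho] below [ln r]. *)
have lamA : (2 * ln 2 - ln r) / s ^+ 3 <= lam x.
  by near: x; exact: near_log_rate_ge.
have ratio_c : signal_ratio x.1 x.2 (n x.1 x.2) (m x.1 x.2) (a x.1 x.2) <= c.
  rewrite le_max; apply/orP; left; rewrite -lee_fin; near: x; exact: near_c'.
have s01 : 0 <= s <= 1 by rewrite subr_ge0 (ltW c1) gerBl ltW.
have e20 : 0 < e / 2 by rewrite divr_gt0.
have low := total_error_lower (a x.1 x.2) nx mx (xi_iid x.1 x.2) s01 e20 tpsi.
apply: (le_trans _ low).
set rho := expR _.
have rhor : rho <= r.
  rewrite -[leRHS]lnK ?posrE// ler_expR.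
  apply: (le_trans (moment_bound_le nx mx _ _ ratio_c)).
  - by rewrite c0.
  - exact: lt_le_trans lam1.
  by rewrite lerBlDr -lerBlDl -ler_pdivrMl// mulrC.
have rC : r * (1 + C) = e / 2 by rewrite divfK// gt_eqF// addr_gt0.
have : rho * (1 + C) <= r * (1 + C) by rewrite ler_wpM2r// ltW// addr_gt0.
rewrite rC -/C => h; rewrite lee_fin; lra.
Unshelve. all: by end_near. Qed.

Context (eta : nat -> nat -> R) (K L : nat -> nat -> nat).
Hypothesis a_gt0 : forall N M, 0 < a N M.
Hypothesis eta_gt0 : forall N M, 0 < eta N M.
Hypothesis eta_0 : eta x.1 x.2 @[x --> NM_oo] --> (0 : R).
Hypothesis eta_o : (fun x : nat * nat => `|ln (eta x.1 x.2)|) =o_NM_oo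
  (fun x : nat * nat =>
    `|ln (((n x.1 x.2)%:R / x.1%:R) * ((m x.1 x.2)%:R / x.2%:R))| : R).
Hypothesis gK : forall N M, (0 < n N M)%N ->
  grid_size N (n N M) (eta N M) (K N M).
Hypothesis gL : forall N M, (0 < m N M)%N ->
  grid_size M (m N M) (eta N M) (L N M).

Lemma near_ln_eta_le (k : R) : 0 < k ->
  \forall x \near NM_oo, `|ln (eta x.1 x.2)| <= k * lam x.
Proof.
move=> k0; near=> x.
have [nx mx] : (0 < n x.1 x.2 <= x.1)%N /\ (0 < m x.1 x.2 <= x.2)%N.
  by near: x; exact: near_size_gt0.
have lam1 : 0 <= lam x by near: x; exact: near_log_rate_ge.
have : `| `|ln (eta x.1 x.2)| | <= k * `| `|ln (((n x.1 x.2)%:R / x.1%:R) *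
    ((m x.1 x.2)%:R / x.2%:R))| | :> R.
  by near: x; move/eqoP : eta_o; exact.
by rewrite !normr_id ln_ratioE// normrN (ger0_norm lam1).
Unshelve. all: by end_near. Qed.

(** The number of grid points diverges, hence so does the threshold; this makes the term
    [expR (- H / J%:R)] of the type I bound vanish for fixed [J]. *)
Lemma near_threshold_ge (A : R) : \forall x \near NM_oo,
  A <= Num.sqrt (2 * ln (K x.1 x.2 * L x.1 x.2)%:R).
Proof.
near=> x.
have [nx mx] : (0 < n x.1 x.2 <= x.1)%N /\ (0 < m x.1 x.2 <= x.2)%N.
  by near: x; exact: near_size_gt0.
have eta1 : `|eta x.1 x.2| <= 1.
  by near: x; have /cvgr0Pnorm_le := eta_0; apply.
have eta01 : 0 < eta x.1 x.2 <= 1.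
  by rewrite eta_gt0 -[X in X <= 1]ger0_norm// ltW.
have [/andP[n0 _] /andP[m0 _]] := (nx, mx).
have K0 := (gK n0).1; have L0 := (gL m0).1.
(* The summand 1 compensates the loss in [grid_size_ge]. *)
have big : expR (A ^+ 2 / 2) + 1 <= ((n x.1 x.2)%:R / x.1%:R)^-1.
  by near: x; exact: near_ratio_ge.
have KA : expR (A ^+ 2 / 2) <= (K x.1 x.2 * L x.1 x.2)%:R.
  apply: (@le_trans _ _ (K x.1 x.2)%:R); last by rewrite ler_nat leq_pmulr.
  by have := grid_size_ge nx eta01 (gK n0); lra.
apply: (le_trans (ler_norm A)); rewrite -sqrtr_sqr ler_sqrt.
  rewrite -ler_pdivrMl// mulrC -[leLHS]expRK ler_ln ?posrE ?expR_gt0//.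
  by rewrite ltr0n muln_gt0 K0.
by rewrite mulr_ge0// ln_ge0// ler1n muln_gt0 K0.
Unshelve. all: by end_near. Qed.

(** Each of the three terms of [scan_test_total_error] is brought below [e / 3]: first [J] is fixed
    from [e] alone, then the threshold and the detection margin grow. *)
Lemma scan_test_cvg :
  (1 < limf_einf (fun x : nat * nat =>
      (signal_ratio x.1 x.2 (n x.1 x.2) (m x.1 x.2) (a x.1 x.2))%:E)
      NM_oo)%E ->
  total_error (@xi x.1 x.2) (n x.1 x.2) (m x.1 x.2) (a x.1 x.2)
    (scan_test (n x.1 x.2) (m x.1 x.2) (eta x.1 x.2)
       (K x.1 x.2) (L x.1 x.2)) @[x --> NM_oo] --> 0%E.
Proof.
move=> /lt_limf_einf[c c1 near_c]; apply: cvge_near => e e0.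
have sc1 : 1 < Num.sqrt c by rewrite -sqrtr1 ltr_sqrt// (lt_trans ltr01).
(* The tolerances of [detection_margin]: [k] for the threshold, [dl] for the overlap loss in each
   direction, the latter shared equally between rounding and mesh. *)
pose k := (Num.sqrt c - 1) / 4; pose dl := (Num.sqrt c - 1) / (8 * Num.sqrt c).
have k0 : 0 < k by rewrite divr_gt0// subr_gt0.
have [dl0 dl1] : 0 < dl /\ dl <= 1.
  have sc0 := lt_trans ltr01 sc1.
  split; first by rewrite divr_gt0 ?subr_gt0// mulr_gt0.
  rewrite ler_pdivrMr ?mulr_gt0// mul1r lerBlDr (@le_trans _ _ (8 * Num.sqrt c))//.
    by rewrite ler_peMl ?ler1n// ltW.
  by rewrite lerDl.
have dl20 : 0 < dl / 2 by rewrite divr_gt0.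
have e30 : 0 < e / 3 by rewrite divr_gt0.
pose J := (Num.truncn (expR 1 / (e / 3))).+1.
have J0R : 0 < J%:R :> R by rewrite ltr0n.
have JE : expR 1 / J%:R <= e / 3.
  by rewrite ler_pdivrMr// mulrC -ler_pdivrMr// ltW// truncnS_gt.
(* The value that [Num.sqrt (2 * lam x)] has to reach in [detection_margin]. *)
pose t := 2 * `|2^-1 - ln (e / 3)| / (Num.sqrt c - 1).
have small (q : nat) : (Num.truncn (dl / 2)^-1 < q)%N -> q%:R^-1 <= dl / 2.
  move=> tq; have q0 : (0 < q)%N by exact: leq_ltn_trans tq.
  rewrite -[leRHS]invrK lef_pV2 ?posrE ?invr_gt0 ?ltr0n//.
  by rewrite (le_trans (ltW (truncnS_gt _)))// ler_nat.
near=> x.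
have [nx mx] : (0 < n x.1 x.2 <= x.1)%N /\ (0 < m x.1 x.2 <= x.2)%N.
  by near: x; exact: near_size_gt0.
have [/andP[n0 _] /andP[m0 _]] := (nx, mx).
have lam1 : 1 <= lam x by near: x; exact: near_log_rate_ge.
have lam0 := lt_le_trans ltr01 lam1.
have lamt : t ^+ 2 / 2 <= lam x by near: x; exact: near_log_rate_ge.
have etad : eta x.1 x.2 <= dl / 2.
  rewrite -[eta _ _]ger0_norm ?(ltW (eta_gt0 _ _))//.
  by near: x; have /cvgr0Pnorm_le := eta_0; apply.
have half : dl / 2 + dl / 2 = dl by rewrite -splitr.
have eta01 : 0 < eta x.1 x.2 <= 1.
  by rewrite eta_gt0 (le_trans etad)// (le_trans _ dl1)// -[leRHS]half lerDl ltW.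
have nd : (n x.1 x.2)%:R^-1 + eta x.1 x.2 <= dl.
  rewrite -[leRHS]half lerD//; apply: small.
  by near: x; have /cvgnyPge := n_oo; exact.
have md : (m x.1 x.2)%:R^-1 + eta x.1 x.2 <= dl.
  rewrite -[leRHS]half lerD//; apply: small.
  by near: x; have /cvgnyPge := m_oo; exact.
have ratio_c : c <= signal_ratio x.1 x.2 (n x.1 x.2) (m x.1 x.2) (a x.1 x.2).
  by rewrite -lee_fin; near: x; exact: near_c.
have lneta : `|ln (eta x.1 x.2)| <= k * lam x by near: x; exact: near_ln_eta_le.
have hH := scan_threshold_le nx mx eta01 (gK n0) (gL m0) (ltW k0) lneta.
(* The condition [expR (- H / J%:R) <= e / 3] solved for the threshold [H]. *)
have hJ : - (ln (e / 3) * J%:R) <=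
    Num.sqrt (2 * ln (K x.1 x.2 * L x.1 x.2)%:R).
  by near: x; exact: near_threshold_ge.
have hg := signal_strength_ge (a_gt0 x.1 x.2) lam0 (ltW (lt_trans ltr01 c1))
  ratio_c.
have /andP[tot0 tot1] := scan_test_total_error (xi_iid x.1 x.2) nx mx
  (eta_gt0 x.1 x.2) (a_gt0 x.1 x.2) (le_trans nd dl1) (le_trans md dl1)
  (gK n0) (gL m0) (ltn0Sn _ : 0 < J)%N.
rewrite sub0r add0r; apply/andP; split.
  by apply: le_trans tot0; rewrite lee_fin oppr_le0 ltW.
have e3 : e = e / 3 + e / 3 + e / 3 by field.
apply: (le_trans tot1); rewrite lee_fin [leRHS]e3.
apply: lerD; first apply: lerD => //.
  by rewrite -[leRHS]lnK ?posrE// ler_expR ler_pdivrMr// lerNl.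
apply: (detection_margin sc1 e30 _ hg hH nd md).
have t0 : 0 <= t by rewrite divr_ge0 ?mulr_ge0 ?normr_ge0// subr_ge0 ltW.
rewrite -/t -(ger0_norm t0) -sqrtr_sqr ler_sqrt ?mulr_ge0 ?(ltW lam0)//.
by rewrite -ler_pdivrMl// mulrC.
Unshelve. all: by end_near. Qed.

End asymptotics.

(** * From a bound on every test to the minimax errors *)

Section minimax.
Context (R : realType) (n m : nat -> nat -> nat).
Context (d : nat -> nat -> measure_display)
  (T : forall N M, measurableType (d N M))
  (P : forall N M, probability (T N M) R)
  (xi : forall N M, 'I_N -> 'I_M -> {RV (P N M) >-> R}) (a : nat -> nat -> R).
Hypothesis near_size : \forall x \near NM_oo,
  (0 < n x.1 x.2 <= x.1)%N /\ (0 < m x.1 x.2 <= x.2)%N.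
Hypothesis near_total_error : forall e : R, 0 < e ->
  \forall x \near NM_oo, forall psi, is_test psi ->
    ((1 - e)%:E <=
     total_error (@xi x.1 x.2) (n x.1 x.2) (m x.1 x.2) (a x.1 x.2) psi)%E.

(** The test identically 0 has total error at most 1, matching the lower bound assumed for all
    tests. *)
Lemma minimax_total_error_cvg :
  minimax_total_error (@xi x.1 x.2) (n x.1 x.2) (m x.1 x.2) (a x.1 x.2)
    @[x --> NM_oo] --> 1%E.
Proof.
apply: cvge_near => e e0; near=> x; apply/andP; split.
  apply: le_ereal_inf_tmp => _ [psi tpsi <-].
  by move: psi tpsi; near: x; exact: near_total_error.
apply: (@le_trans _ _ 1%E); last by rewrite lee_fin lerDl ltW.
apply: (@le_trans _ _ (total_error (@xi x.1 x.2) (n x.1 x.2) (m x.1 x.2)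
    (a x.1 x.2) (fun=> 0))).
  by apply: ereal_inf_lbound; exists (fun=> 0) => //; apply: is_test_cst;
    rewrite lexx ler01.
rewrite /total_error type1_cst add0e (le_trans (type2_cst_le _ _ _ _ _))//.
by rewrite subr0.
Unshelve. all: by end_near. Qed.

(** A test of level [alpha] has type II error at least its total error minus [alpha]; conversely the
    constant randomised test [alpha] has type II error at most [1 - alpha]. *)
Lemma minimax_type2_cvg (alpha : R) : 0 < alpha < 1 ->
  minimax_type2 (@xi x.1 x.2) (n x.1 x.2) (m x.1 x.2) (a x.1 x.2) alpha
    @[x --> NM_oo] --> (1 - alpha)%:E.
Proof.
move=> /andP[al0 al1]; apply: cvge_near => e e0; near=> x; apply/andP; split.
  apply: le_ereal_inf_tmp => _ [psi [tpsi psi_al] <-].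
  have [nx mx] : (0 < n x.1 x.2 <= x.1)%N /\ (0 < m x.1 x.2 <= x.2)%N.
    by near: x; exact: near_size.
  have : ((1 - e)%:E <= total_error (@xi x.1 x.2) (n x.1 x.2) (m x.1 x.2)
      (a x.1 x.2) psi)%E.
    by move: psi tpsi {psi_al}; near: x; exact: near_total_error.
  move/le_trans => /(_ _ (leeD2r _ psi_al)).
  rewrite -(fineK (type2_fin_num (@xi x.1 x.2) (a x.1 x.2) nx mx tpsi)).
  by rewrite -EFinD !lee_fin; lra.
apply: (@le_trans _ _ (1 - alpha)%:E); last by rewrite lee_fin lerDl ltW.
apply: (@le_trans _ _ (type2 (@xi x.1 x.2) (n x.1 x.2) (m x.1 x.2)
    (a x.1 x.2) (fun=> alpha))); last exact: type2_cst_le.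
apply: ereal_inf_lbound; exists (fun=> alpha) => //; split.
  by apply: is_test_cst; rewrite (ltW al0) ltW.
by rewrite type1_cst.
Unshelve. all: by end_near. Qed.

End minimax.

Theorem theorem4p4 (R : realType)
    (d : nat -> nat -> measure_display)
    (T : forall N M, measurableType (d N M))
    (P : forall N M, probability (T N M) R)
    (xi : forall N M, 'I_N -> 'I_M -> {RV (P N M) >-> R})
    (n m : nat -> nat -> nat) (a : nat -> nat -> R)
    (xi_iid : forall N M, iid_std_normal (xi N M))
    (n_le : forall N M, (n N M <= N)%N)
    (m_le : forall N M, (m N M <= M)%N)
    (a_gt0 : forall N M, 0 < a N M)
    (n_oo : n x.1 x.2 @[x --> NM_oo] --> \oo)
    (m_oo : m x.1 x.2 @[x --> NM_oo] --> \oo)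
    (p_0 : ((n x.1 x.2)%:R / x.1%:R : R) @[x --> NM_oo] --> (0 : R))
    (q_0 : ((m x.1 x.2)%:R / x.2%:R : R) @[x --> NM_oo] --> (0 : R)) :
  ((1 < limf_einf (fun x : nat * nat =>
          (signal_ratio x.1 x.2 (n x.1 x.2) (m x.1 x.2) (a x.1 x.2))%:E)
          NM_oo)%E ->
    forall (eta : nat -> nat -> R) (K L : nat -> nat -> nat),
    (forall N M, 0 < eta N M) ->
    eta x.1 x.2 @[x --> NM_oo] --> (0 : R) ->
    (n x.1 x.2)%:R * eta x.1 x.2 @[x --> NM_oo] --> +oo ->
    (m x.1 x.2)%:R * eta x.1 x.2 @[x --> NM_oo] --> +oo ->
    (fun x : nat * nat => `|ln (eta x.1 x.2)|) =o_NM_oo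
      (fun x : nat * nat =>
         `|ln (((n x.1 x.2)%:R / x.1%:R) * ((m x.1 x.2)%:R / x.2%:R))| : R) ->
    (forall N M, (0 < n N M)%N -> grid_size N (n N M) (eta N M) (K N M)) ->
    (forall N M, (0 < m N M)%N -> grid_size M (m N M) (eta N M) (L N M)) ->
    total_error (xi x.1 x.2) (n x.1 x.2) (m x.1 x.2) (a x.1 x.2)
      (scan_test (n x.1 x.2) (m x.1 x.2) (eta x.1 x.2)
         (K x.1 x.2) (L x.1 x.2))
      @[x --> NM_oo] --> 0%E)
  /\
  ((limf_esup (fun x : nat * nat =>
      (signal_ratio x.1 x.2 (n x.1 x.2) (m x.1 x.2) (a x.1 x.2))%:E)
      NM_oo < 1)%E ->
    minimax_total_error (xi x.1 x.2) (n x.1 x.2) (m x.1 x.2) (a x.1 x.2)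
      @[x --> NM_oo] --> 1%E
    /\
    forall alpha : R, 0 < alpha < 1 ->
      minimax_type2 (xi x.1 x.2) (n x.1 x.2) (m x.1 x.2) (a x.1 x.2) alpha
        @[x --> NM_oo] --> (1 - alpha)%:E).
Proof.
split=> [ratio eta K L eta0 eta_0 _ _ eta_o gK gL|ratio].
  exact: scan_test_cvg.
have near_total e e0 := near_total_error_ge n_le m_le n_oo m_oo p_0 xi_iid
  (a := a) (e := e) ratio e0.
have near_size := near_size_gt0 n_le m_le n_oo m_oo.
split; first exact: minimax_total_error_cvg.
by move=> alpha alpha01; exact: minimax_type2_cvg.
Qed.
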